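(* Let $A$ be a Banach $D$-module with finite basis $(e_{A\cdot j})$, and let $B$ be a free finite-dimensional associative Banach $D$-algebra with basis $(e_{B\cdot i})$ as a $D$-module. Let $g:A\to\mathcal{L}(D;A\to B)$ be a differentiable map with coordinates $g^i_j:A\to D$, i.e. $g(x)\circ e_{A\cdot j}=\sum_i g^i_j(x)e_{B\cdot i}$. Then the differential equation $$\frac{dy}{dx}=g(x)$$ is integrable if and only if the corresponding system of differential equations $$\frac{\partial y^i}{\partial x^j}=g^i_j(x),\qquad y=\sum_i y^ie_{B\cdot i},\quad x=\sum_j x^je_{A\cdot j},$$ is completely integrable.
   Context: $D$ is a complete commutative (normed) ring of characteristic $0$; real scalars act on $D$-modules (derivatives are computed with real increments $t\to0$). $\mathcal{L}(D;A\to B)$ is the $D$-module of (continuous) $D$-linear maps; the derivative $\frac{df(x)}{dx}\in\mathcal{L}(D;A\to B)$ of $f:A\to B$ satisfies $f(x+h)-f(x)=\frac{df(x)}{dx}\circ h+o(h)$. The equation $\frac{dy}{dx}=g(x)$ is integrable if there exists $f:A\to B$ with $\frac{df(x)}{dx}=g(x)$ for all $x$. The partial derivative with respect to $x^j$ is $\frac{\partial u}{\partial x^j}=\frac{du}{dx}\circ e_{A\cdot j}$. The system $\frac{\partial y^i}{\partial x^j}=g^i_j(x)$ is completely integrable if its compatibility conditions $\frac{\partial g^i_j}{\partial x^k}=\frac{\partial g^i_k}{\partial x^j}$ hold identically in $x$ for all $i,j,k$. *)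

(* Defs.v *)
(* Stdlib reals with the normed-module hierarchy of Coquelicot. *)
From Stdlib Require Import Reals Lra Arith.
From Stdlib Require Import FunctionalExtensionality ProofIrrelevance.
From Coquelicot Require Import Coquelicot.

Open Scope R_scope.

(* [AbsRing] already provides a ring (associative, unital) with a separated,
   submultiplicative norm such that |-1| = 1.  [real_scalar] is the action of
   the real scalars: an isometric ring morphism from R. *)
Record RealBanachRing : Type := {
  rbr_ring :> AbsRing;
  rbr_comm : forall a b : rbr_ring, mult a b = mult b a;
  rbr_complete : forall F : (rbr_ring -> Prop) -> Prop,
    ProperFilter F -> cauchy F ->
    exists a : rbr_ring, forall eps : posreal, F (ball a eps);
  rbr_char0 : forall n : nat, (0 < n)%nat ->
    sum_n_m (fun _ : nat => (one : rbr_ring)) 1 n <> zero;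
  real_scalar : R -> rbr_ring;
  real_scalar_one : real_scalar 1 = one;
  real_scalar_plus : forall r s : R,
    real_scalar (r + s) = plus (real_scalar r) (real_scalar s);
  real_scalar_mult : forall r s : R,
    real_scalar (r * s) = mult (real_scalar r) (real_scalar s);
  real_scalar_abs : forall r : R, abs (real_scalar r) = Rabs r
}.

(* Not required to be unital or commutative. *)
Record BanachAlgebra (D : RealBanachRing) : Type := {
  alg_module :> CompleteNormedModule D;
  alg_mul : alg_module -> alg_module -> alg_module;
  alg_mul_assoc : forall a b c : alg_module,
    alg_mul a (alg_mul b c) = alg_mul (alg_mul a b) c;
  alg_mul_plus_l : forall a b c : alg_module,
    alg_mul (plus a b) c = plus (alg_mul a c) (alg_mul b c);
  alg_mul_plus_r : forall a b c : alg_module,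
    alg_mul a (plus b c) = plus (alg_mul a b) (alg_mul a c);
  alg_mul_scal_l : forall (d : D) (a b : alg_module),
    alg_mul (scal d a) b = scal d (alg_mul a b);
  alg_mul_scal_r : forall (d : D) (a b : alg_module),
    alg_mul a (scal d b) = scal d (alg_mul a b);
  alg_mul_norm : forall a b : alg_module,
    norm (alg_mul a b) <= norm a * norm b
}.

(* Bases and coordinates are indexed by 1, ..., n; values of families outside
   this range are irrelevant, and n = 0 (zero module) is allowed. *)
Definition is_basis {D : RealBanachRing} {V : NormedModule D}
    (n : nat) (e : nat -> V) : Prop :=
  (forall v : V, exists c : nat -> D,
     v = sum_n_m (fun i => scal (c i) (e i)) 1 n) /\
  (forall c : nat -> D,
     sum_n_m (fun i => scal (c i) (e i)) 1 n = zero ->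
     forall i : nat, (1 <= i <= n)%nat -> c i = zero).

(** * The normed D-module L(D; A -> B) *)

(* [is_linear] includes boundedness. *)
Record LinMap (D : RealBanachRing) (A B : NormedModule D) : Type := {
  lin_fun :> A -> B;
  lin_is_linear : is_linear lin_fun
}.

Arguments lin_fun {D A B} _ _.
Arguments lin_is_linear {D A B} _.

Section LinMapSpace.

Context {D : RealBanachRing} {A B : NormedModule D}.

Implicit Types l m : LinMap D A B.

Lemma lin_ext l m : (forall x, l x = m x) -> l = m.
Proof.
destruct l as [l Hl], m as [m Hm]; simpl; intros H.
assert (E : l = m) by (apply functional_extensionality; exact H).
subst m; f_equal; apply proof_irrelevance.
Qed.

Lemma lin_zero_subproof : is_linear (fun _ : A => zero : B).
Proof. apply is_linear_zero. Qed.

Lemma lin_plus_subproof l m : is_linear (fun x => plus (l x) (m x)).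
Proof.
apply (is_linear_comp (fun x => (l x, m x)) (fun p => plus (fst p) (snd p))).
- apply is_linear_prod; apply lin_is_linear.
- apply is_linear_plus.
Qed.

Lemma lin_opp_subproof l : is_linear (fun x => opp (l x)).
Proof.
apply (is_linear_comp l opp); [apply lin_is_linear | apply is_linear_opp].
Qed.

Lemma lin_scal_subproof (d : D) l : is_linear (fun x => scal d (l x)).
Proof.
apply (is_linear_comp l (scal d)); [apply lin_is_linear|].
apply is_linear_scal_r; intros; apply rbr_comm.
Qed.

Definition lin_zero : LinMap D A B := Build_LinMap D A B _ lin_zero_subproof.
Definition lin_plus l m : LinMap D A B :=
  Build_LinMap D A B _ (lin_plus_subproof l m).
Definition lin_opp l : LinMap D A B :=
  Build_LinMap D A B _ (lin_opp_subproof l).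
Definition lin_scal (d : D) l : LinMap D A B :=
  Build_LinMap D A B _ (lin_scal_subproof d l).

(* sup of |l x| / |x|; at x = 0 the quotient is 0, which does not affect the
   supremum and makes it 0 for A = 0. *)
Definition lin_norm l : R :=
  real (Lub_Rbar (fun r => exists x : A, r = norm (l x) / norm x)).

Lemma lin_quot_le l (M : R) (x : A) :
  0 <= M -> norm (l x) <= M * norm x -> norm (l x) / norm x <= M.
Proof.
intros HM H.
destruct (norm_ge_0 x) as [Hx | Hx].
- apply Rmult_le_reg_r with (norm x); [exact Hx|].
  unfold Rdiv; rewrite Rmult_assoc, Rinv_l; lra.
- rewrite <- Hx, Rmult_0_r in H.
  assert (E : norm (l x) = 0) by (generalize (norm_ge_0 (l x)); lra).
  rewrite E; unfold Rdiv; lra.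
Qed.

Lemma lin_norm_lub l :
  is_lub_Rbar (fun r => exists x : A, r = norm (l x) / norm x)
    (Finite (lin_norm l)).
Proof.
unfold lin_norm.
set (E := fun r => exists x : A, r = norm (l x) / norm x).
destruct (Lub_Rbar_correct E) as [H1 H2].
destruct (linear_norm _ (lin_is_linear l)) as [M [HM Hl]].
assert (HU : Rbar_le (Lub_Rbar E) (Finite M)).
{ apply H2; intros r [x ->]; apply lin_quot_le; [lra | apply Hl]. }
assert (HL := H1 _ (ex_intro _ (zero : A) eq_refl)).
destruct (Lub_Rbar E); simpl in *; try contradiction.
split; assumption.
Qed.

Lemma lin_norm_le l (M : R) :
  0 <= M -> (forall x, norm (l x) <= M * norm x) -> lin_norm l <= M.
Proof.
intros HM H; apply (proj2 (lin_norm_lub l) (Finite M)).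
intros r [x ->]; apply lin_quot_le; auto.
Qed.

Lemma lin_norm_ge_0 l : 0 <= lin_norm l.
Proof.
assert (H := proj1 (lin_norm_lub l) _ (ex_intro _ (zero : A) eq_refl)).
simpl in H; rewrite (linear_zero _ (lin_is_linear l)), (@norm_zero D B) in H.
unfold Rdiv in H; lra.
Qed.

Lemma lin_norm_bound l x : norm (l x) <= lin_norm l * norm x.
Proof.
destruct (norm_ge_0 x) as [Hx | Hx].
- assert (H := proj1 (lin_norm_lub l) _ (ex_intro _ x eq_refl)); simpl in H.
  apply Rmult_le_compat_r with (r := norm x) in H; [|lra].
  unfold Rdiv in H; rewrite Rmult_assoc, Rinv_l in H; lra.
- assert (E := norm_eq_zero x (eq_sym Hx)); subst x.
  rewrite (linear_zero _ (lin_is_linear l)), !norm_zero; lra.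
Qed.

Definition lin_AbelianMonoid_mixin : AbelianMonoid.mixin_of (LinMap D A B).
Proof.
apply (AbelianMonoid.Mixin (LinMap D A B) lin_plus lin_zero);
  intros; apply lin_ext; intros; simpl.
- apply plus_comm.
- apply plus_assoc.
- apply plus_zero_r.
Defined.

Canonical lin_AbelianMonoid :=
  AbelianMonoid.Pack (LinMap D A B) lin_AbelianMonoid_mixin (LinMap D A B).

Definition lin_AbelianGroup_mixin : AbelianGroup.mixin_of lin_AbelianMonoid.
Proof.
apply (AbelianGroup.Mixin lin_AbelianMonoid lin_opp).
intros; apply lin_ext; intros; simpl; apply (@plus_opp_r B).
Defined.

Canonical lin_AbelianGroup :=
  AbelianGroup.Pack (LinMap D A B) (AbelianGroup.Class _ _ lin_AbelianGroup_mixin)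
    (LinMap D A B).

Definition lin_ModuleSpace_mixin : ModuleSpace.mixin_of D lin_AbelianGroup.
Proof.
apply (ModuleSpace.Mixin D lin_AbelianGroup lin_scal);
  intros; apply lin_ext; intros; simpl.
- apply (@scal_assoc D B).
- apply (@scal_one D B).
- apply (@scal_distr_l D B).
- apply (@scal_distr_r D B).
Defined.

Canonical lin_ModuleSpace :=
  ModuleSpace.Pack D (LinMap D A B) (ModuleSpace.Class D _ _ lin_ModuleSpace_mixin)
    (LinMap D A B).

Definition lin_ball l (eps : R) m : Prop := lin_norm (minus m l) < eps.

Lemma lin_norm_triangle l m : lin_norm (plus l m) <= lin_norm l + lin_norm m.
Proof.
apply lin_norm_le.
- generalize (lin_norm_ge_0 l) (lin_norm_ge_0 m); lra.
- intros x; simpl.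
  eapply Rle_trans; [apply norm_triangle|].
  generalize (lin_norm_bound l x) (lin_norm_bound m x); lra.
Qed.

Lemma lin_norm_scal (d : D) l : lin_norm (scal d l) <= abs d * lin_norm l.
Proof.
apply lin_norm_le.
- apply Rmult_le_pos; [apply abs_ge_0 | apply lin_norm_ge_0].
- intros x; simpl.
  eapply Rle_trans; [apply norm_scal|].
  rewrite Rmult_assoc; apply Rmult_le_compat_l;
    [apply abs_ge_0 | apply lin_norm_bound].
Qed.

Lemma lin_norm_opp_le l : lin_norm (opp l) <= lin_norm l.
Proof.
apply lin_norm_le; [apply lin_norm_ge_0|].
intros x; simpl; rewrite norm_opp; apply lin_norm_bound.
Qed.

Lemma lin_norm_zero : lin_norm zero = 0.
Proof.
apply Rle_antisym; [|apply lin_norm_ge_0].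
apply lin_norm_le; [lra|].
intros x; simpl; rewrite norm_zero; lra.
Qed.

Lemma lin_norm_eq_zero l : lin_norm l = 0 -> l = zero.
Proof.
intros H; apply lin_ext; intros x; simpl.
apply norm_eq_zero.
generalize (lin_norm_bound l x) (norm_ge_0 (l x)); rewrite H; lra.
Qed.

Definition lin_UniformSpace_mixin : UniformSpace.mixin_of (LinMap D A B).
Proof.
apply (UniformSpace.Mixin (LinMap D A B) lin_zero lin_ball);
  unfold lin_ball.
- intros l eps.
  replace (minus l l) with (zero : lin_AbelianGroup)
    by (symmetry; apply minus_eq_zero).
  eapply Rle_lt_trans; [apply Req_le, lin_norm_zero | apply cond_pos].
- intros l m eps H.
  rewrite <- (@opp_minus lin_AbelianGroup).
  eapply Rle_lt_trans; [apply lin_norm_opp_le | exact H].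
- intros l m p e1 e2 H1 H2.
  rewrite (@minus_trans lin_AbelianGroup m).
  eapply Rle_lt_trans; [apply lin_norm_triangle | lra].
Defined.

Canonical lin_UniformSpace :=
  UniformSpace.Pack (LinMap D A B) lin_UniformSpace_mixin (LinMap D A B).

Canonical lin_NormedModuleAux :=
  NormedModuleAux.Pack D (LinMap D A B)
    (NormedModuleAux.Class D _ (ModuleSpace.class D lin_ModuleSpace)
       lin_UniformSpace_mixin) (LinMap D A B).

Definition lin_NormedModule_mixin : NormedModule.mixin_of D lin_NormedModuleAux.
Proof.
apply (NormedModule.Mixin D lin_NormedModuleAux lin_norm 1).
- exact lin_norm_triangle.
- exact lin_norm_scal.
- intros l m eps H; exact H.
- intros l m eps H; rewrite Rmult_1_l; exact H.
- exact lin_norm_eq_zero.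
Defined.

Canonical lin_NormedModule :=
  NormedModule.Pack D (LinMap D A B) (NormedModule.Class D _ _ lin_NormedModule_mixin)
    (LinMap D A B).

End LinMapSpace.

(** * Differential equations *)

Definition differentiable {D : RealBanachRing} {U V : NormedModule D}
    (f : U -> V) : Prop :=
  forall x : U, ex_filterdiff f (locally x).

(* [filterdiff f (locally x) l] : the derivative of f at x is l. *)
Definition integrable {D : RealBanachRing} {A B : NormedModule D}
    (g : A -> LinMap D A B) : Prop :=
  exists f : A -> B, forall x : A, filterdiff f (locally x) (g x).

(* The partial derivative of u along the basis vector e exists at x and is v. *)
Definition is_partial {D : RealBanachRing} {A : NormedModule D}
    (u : A -> D) (e x : A) (v : D) : Prop :=
  exists l : LinMap D A (AbsRing_NormedModule D),
    filterdiff u (locally x) l /\ l e = v.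

(* [g i j] is the right-hand side of the equation for the derivative of y^i
   along x^j, with 1 <= i <= n and 1 <= j <= m. *)
Definition completely_integrable {D : RealBanachRing} {A : NormedModule D}
    (m n : nat) (e : nat -> A) (g : nat -> nat -> A -> D) : Prop :=
  forall i j k : nat,
    (1 <= i <= n)%nat -> (1 <= j <= m)%nat -> (1 <= k <= m)%nat ->
    forall x : A, exists v : D,
      is_partial (g i j) (e k) x v /\ is_partial (g i k) (e j) x v.

(* Main.v *)
(** Restricting scalars to the reals turns the modules into real Banach spaces.
   There, a differentiable 1-form [g] is compared along a segment with its
   first-order expansion at a nearby point [x]: up to a small error, the
   circulation of [g] around a small triangle is half the antisymmetric part
   of the derivative of [g] at [x].  If [g] has a primitive, all circulations vanish,
   and scaling the triangle gives the symmetry of the derivative.  Conversely,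
   if the derivative is symmetric, Goursat's bisection of triangles shows that
   all circulations vanish, and integration along segments from the origin gives
   a primitive.  The symmetry of the derivative is then read in coordinates;
   that the coordinate functionals of a basis are bounded (so that the partial
   derivatives of the coordinates of [g] exist) is an instance of the open mapping
   theorem, obtained from Zabreiko's lemma on countably subadditive seminorms. *)

Require Import Defs.
From Coquelicot Require Import Coquelicot.
From Stdlib Require Import Reals Lra Lia List Compare_dec.
From Stdlib Require Import ClassicalEpsilon.
From Stdlib Require Import FunctionalExtensionality PropExtensionality.

Open Scope R_scope.

(** * Normed modules over the reals *)

Inductive mexp : Type :=
| MVar (i : nat)
| MZero
| MPlus (a b : mexp)
| MOpp (a : mexp)
| MScal (r : R) (a : mexp).

Fixpoint mcoef (e : mexp) (i : nat) : R :=
  match e with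
  | MVar j => if Nat.eqb j i then 1 else 0
  | MZero => 0
  | MPlus a b => mcoef a i + mcoef b i
  | MOpp a => - mcoef a i
  | MScal r a => r * mcoef a i
  end.

Section ModuleNormalisation.

Context {V : ModuleSpace R_Ring}.

Fixpoint meval (env : list V) (e : mexp) : V :=
  match e with
  | MVar i => nth i env zero
  | MZero => zero
  | MPlus a b => plus (meval env a) (meval env b)
  | MOpp a => opp (meval env a)
  | MScal r a => scal (r : R_Ring) (meval env a)
  end.

Fixpoint lin_comb (c : nat -> R) (env : list V) : V :=
  match env with
  | nil => zero
  | v :: l => plus (scal (c O : R_Ring) v) (lin_comb (fun i => c (S i)) l)
  end.

Lemma lin_comb_zero (env : list V) : lin_comb (fun _ => 0) env = zero.
Proof.
induction env as [|v l IH]; simpl; [reflexivity|].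
rewrite IH, plus_zero_r; apply (scal_zero_l v).
Qed.

Lemma lin_comb_plus (c d : nat -> R) (env : list V) :
  lin_comb (fun i => c i + d i) env = plus (lin_comb c env) (lin_comb d env).
Proof.
revert c d; induction env as [|v l IH]; intros c d; simpl.
- now rewrite plus_zero_r.
- rewrite (IH (fun i => c (S i)) (fun i => d (S i))).
  change (c O + d O) with (@plus R_Ring (c O) (d O)).
  rewrite scal_distr_r, <- !plus_assoc; f_equal.
  rewrite !plus_assoc; f_equal; apply plus_comm.
Qed.

Lemma lin_comb_scal (r : R) (c : nat -> R) (env : list V) :
  lin_comb (fun i => r * c i) env = scal (r : R_Ring) (lin_comb c env).
Proof.
revert c; induction env as [|v l IH]; intros c; simpl.
- now rewrite scal_zero_r.
- rewrite (IH (fun i => c (S i))), scal_distr_l; f_equal.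
  change (r * c O) with (@mult R_Ring r (c O)); now rewrite scal_assoc.
Qed.

Lemma lin_comb_ext (c d : nat -> R) (env : list V) :
  (forall i, (i < length env)%nat -> c i = d i) -> lin_comb c env = lin_comb d env.
Proof.
revert c d; induction env as [|v l IH]; intros c d H; simpl; [reflexivity|].
rewrite (H O) by (simpl; lia); f_equal; apply IH.
intros i Hi; apply H; simpl; lia.
Qed.

Lemma lin_comb_var (j : nat) (env : list V) :
  nth j env zero = lin_comb (fun i => if Nat.eqb j i then 1 else 0) env.
Proof.
revert j; induction env as [|v l IH]; intros [|j]; simpl; try reflexivity.
- rewrite lin_comb_zero, plus_zero_r; symmetry; apply (scal_one v).
- rewrite IH, (scal_zero_l v : scal (0 : R_Ring) v = zero), plus_zero_l; reflexivity.
Qed.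

Lemma meval_lin_comb (env : list V) (e : mexp) :
  meval env e = lin_comb (mcoef e) env.
Proof.
induction e as [i| |a IHa b IHb|a IH|r a IH]; simpl.
- apply lin_comb_var.
- symmetry; apply lin_comb_zero.
- now rewrite lin_comb_plus, IHa, IHb.
- rewrite IH, <- (scal_opp_one (lin_comb (mcoef a) env)).
  change (opp (one : R_Ring)) with (- (1)); rewrite <- lin_comb_scal.
  apply lin_comb_ext; intros; ring.
- now rewrite lin_comb_scal, IH.
Qed.

(** By recursion on the atoms rather than by a quantified index, so that [simpl] leaves one real
    identity per atom. *)
Fixpoint coefs_agree (c d : nat -> R) (env : list V) : Prop :=
  match env with
  | nil => True
  | _ :: l => c O = d O /\ coefs_agree (fun i => c (S i)) (fun i => d (S i)) l
  end.

Lemma meval_eq (env : list V) (e1 e2 : mexp) :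
  coefs_agree (mcoef e1) (mcoef e2) env -> meval env e1 = meval env e2.
Proof.
rewrite !meval_lin_comb.
generalize (mcoef e1) (mcoef e2); induction env as [|v l IH]; intros c d;
  simpl; [reflexivity|].
intros [-> H]; f_equal; now apply IH.
Qed.

End ModuleNormalisation.

Ltac mem_atom x l :=
  match l with
  | nil => constr:(false)
  | cons x _ => constr:(true)
  | cons _ ?l' => mem_atom x l'
  end.

Ltac atom_index x l :=
  match l with
  | cons x _ => constr:(O)
  | cons _ ?l' => let n := atom_index x l' in constr:(S n)
  end.

Ltac collect_atoms t l :=
  lazymatch t with
  | plus ?a ?b => let l1 := collect_atoms a l in collect_atoms b l1
  | minus ?a ?b => let l1 := collect_atoms a l in collect_atoms b l1
  | opp ?a => collect_atoms a l
  | scal _ ?a => collect_atoms a l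
  | zero => l
  | _ => match mem_atom t l with
         | true => l
         | false => constr:(cons t l)
         end
  end.

Ltac reify_module t l :=
  lazymatch t with
  | plus ?a ?b =>
      let a1 := reify_module a l in let b1 := reify_module b l in
      constr:(MPlus a1 b1)
  | minus ?a ?b =>
      let a1 := reify_module a l in let b1 := reify_module b l in
      constr:(MPlus a1 (MOpp b1))
  | opp ?a => let a1 := reify_module a l in constr:(MOpp a1)
  | scal ?r ?a => let a1 := reify_module a l in constr:(MScal r a1)
  | zero => constr:(MZero)
  | _ => let i := atom_index t l in constr:(MVar i)
  end.

(** Both sides are reified over a common list of atoms; comparing the coefficients of each atom
    leaves real identities to [ring] or [field]. *)
Ltac module_eq V :=
  match goal with
  | |- ?a = ?b =>
      let l0 := collect_atoms a (@nil V) in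
      let l := collect_atoms b l0 in
      let e1 := reify_module a l in
      let e2 := reify_module b l in
      apply (@meval_eq V l e1 e2); simpl;
      repeat split; try first [ring | field]
  end.

(** The norms of the goal are tried in turn, until the argument of one of them is proved equal to
    [y]. *)
Ltac norm_as y :=
  match goal with
  | |- context [@norm ?K ?V ?x] =>
      replace (@norm K V x) with (@norm K V y)
        by (apply f_equal; module_eq V; try lra)
  end.

Section NormedTools.

Context {V : NormedModule R_AbsRing}.
Implicit Types x y z : V.

(** The axioms give only [<=]; the converse is the same inequality for the scalar [/ r]. *)
Lemma norm_scal_real (r : R) x : norm (scal r x) = Rabs r * norm x.
Proof.
apply Rle_antisym; [apply (norm_scal (r : R_AbsRing) x)|].
destruct (Req_dec r 0) as [->|Hr].
- rewrite Rabs_R0, Rmult_0_l; apply norm_ge_0.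
- assert (H := norm_scal (/ r : R_AbsRing) (scal (r : R_AbsRing) x)).
  replace (scal (/ r : R_AbsRing) (scal (r : R_AbsRing) x)) with x in H by
    (module_eq V; exact Hr).
  change (abs (/ r : R_AbsRing)) with (Rabs (/ r)) in H.
  rewrite Rabs_inv in H.
  assert (0 < Rabs r) by now apply Rabs_pos_lt.
  apply Rmult_le_compat_l with (r := Rabs r) in H; [|lra].
  rewrite <- Rmult_assoc, Rinv_r, Rmult_1_l in H; [exact H | lra].
Qed.

Lemma norm_plus3_le x y z (a b c : R) :
  norm x <= a -> norm y <= b -> norm z <= c ->
  norm (plus (plus x y) z) <= a + b + c.
Proof.
intros Hx Hy Hz.
eapply Rle_trans; [apply norm_triangle|].
generalize (norm_triangle x y); lra.
Qed.

Lemma norm_minus_triangle x y z :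
  norm (minus x z) <= norm (minus x y) + norm (minus y z).
Proof.
replace (minus x z) with (plus (minus x y) (minus y z)) by module_eq V.
apply norm_triangle.
Qed.

Lemma norm_minus_sym x y : norm (minus x y) = norm (minus y x).
Proof. rewrite <- (norm_opp (minus x y)), opp_minus; reflexivity. Qed.

Lemma norm_minus_self x : norm (minus x x) = 0.
Proof. rewrite minus_eq_zero; apply norm_zero. Qed.

(** Balls and norm balls agree only up to the constant [norm_factor], which is absorbed here once
    and for all. *)
Lemma locally_norm_iff x (P : V -> Prop) :
  locally x P <->
  exists d : R, 0 < d /\ forall y, norm (minus y x) < d -> P y.
Proof.
split.
- intros [d H]; exists d; split; [apply cond_pos|].
  intros y Hy; apply H, norm_compat1, Hy.
- intros [d [Hd H]].
  assert (Hf := @norm_factor_gt_0 _ V).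
  assert (Hp : 0 < d / @norm_factor _ V) by now apply Rdiv_lt_0_compat.
  exists (mkposreal _ Hp); intros y Hy; apply H.
  apply norm_compat2 in Hy; simpl in Hy.
  eapply Rlt_le_trans; [exact Hy|].
  right; field; lra.
Qed.

End NormedTools.

(** * Completeness and integrals of continuous functions *)

Lemma geometric_le (r : nat -> R) :
  (forall k, r (S k) <= r k / 2) -> forall k j, r (k + j)%nat <= r k * (1 / 2) ^ j.
Proof.
intros H k j; induction j as [|j IH]; simpl.
- rewrite Nat.add_0_r; lra.
- rewrite Nat.add_succ_r; specialize (H (k + j)%nat); lra.
Qed.


(** A property rather than a structure, so that it passes to a module whose scalars are restricted
    to the reals. *)
Definition filter_complete (V : UniformSpace) : Prop :=
  forall F : (V -> Prop) -> Prop, ProperFilter F -> cauchy F ->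
  exists l : V, forall eps : posreal, F (ball l eps).

(** The limit operator is chosen by [epsilon]. Two filters finer than each other are equal by
    extensionality, so their chosen limits coincide. *)
Lemma complete_packaging (T : Type) (c : NormedModule.class_of R_AbsRing T) :
  filter_complete (NormedModule.Pack R_AbsRing T c T) ->
  exists W : CompleteNormedModule R_AbsRing,
    CompleteNormedModule.NormedModule R_AbsRing W = NormedModule.Pack R_AbsRing T c T.
Proof.
intros H.
set (V := NormedModule.Pack R_AbsRing T c T : UniformSpace) in H.
assert (i : inhabited V) by exact (inhabits (zero : NormedModule.Pack R_AbsRing T c T)).
set (lim := fun F : (V -> Prop) -> Prop =>
  epsilon i (fun l => forall eps : posreal, F (ball l eps))).
assert (H1 : forall F : (V -> Prop) -> Prop, ProperFilter F -> cauchy F ->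
   forall eps : posreal, F (ball (lim F) eps)).
{ intros F HF HC; exact (epsilon_spec i _ (H F HF HC)). }
assert (H2 : forall F1 F2 : (V -> Prop) -> Prop,
   filter_le F1 F2 -> filter_le F2 F1 -> close (lim F1) (lim F2)).
{ intros F1 F2 L1 L2; replace F2 with F1; [intros eps; apply ball_center|].
  apply functional_extensionality; intros P.
  apply propositional_extensionality; split; [apply L2 | apply L1]. }
exists (CompleteNormedModule.Pack R_AbsRing T
  (CompleteNormedModule.Class R_AbsRing T c (CompleteSpace.Mixin V lim H1 H2)) T).
reflexivity.
Qed.

(* The last field of [NormedModule.Pack] is a phantom on which no operation
   depends, so the second premise holds by conversion for most [P]. *)
Lemma complete_ind (P : NormedModule R_AbsRing -> Prop) :
  (forall W : CompleteNormedModule R_AbsRing, P W) ->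
  (forall T c T', P (NormedModule.Pack R_AbsRing T c T) ->
     P (NormedModule.Pack R_AbsRing T c T')) ->
  forall V : NormedModule R_AbsRing, filter_complete V -> P V.
Proof.
intros HW HT [T c T'] HV; apply HT.
destruct (complete_packaging T c HV) as [W <-]; apply HW.
Qed.

Section BanachSpace.

Context {V : NormedModule R_AbsRing}.
Hypothesis V_complete : filter_complete V.

(** The radii at least halve at each step, so the increments from index [k] on add up to at most
    [2 * r k], and the sequence is Cauchy. *)
Lemma nested_limit (a : nat -> V) (r : nat -> R) :
  (forall k, norm (minus (a (S k)) (a k)) <= r k) ->
  (forall k, r (S k) <= r k / 2) ->
  exists l : V, forall k, norm (minus l (a k)) <= 2 * r k.
Proof.
intros Ha Hr.
assert (H0 : forall k, 0 <= r k).
{ intros k; exact (Rle_trans _ _ _ (norm_ge_0 _) (Ha k)). }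
(* The subtracted term [2 * r (k + j)] pays for the later increments and makes the induction on [j]
   close. *)
assert (Hd : forall k j, norm (minus (a (k + j)%nat) (a k)) <= 2 * r k - 2 * r (k + j)%nat).
{ intros k j; induction j as [|j IH].
  - rewrite Nat.add_0_r, norm_minus_self; lra.
  - eapply Rle_trans; [apply (norm_minus_triangle _ (a (k + j)%nat))|].
    rewrite Nat.add_succ_r.
    specialize (Ha (k + j)%nat); specialize (Hr (k + j)%nat); lra. }
assert (Hsmall : forall eps, 0 < eps -> exists N, r N < eps).
{ intros eps He.
  assert (Hlt : Rabs (1 / 2) < 1) by (rewrite Rabs_right; lra).
  assert (He' : 0 < eps / (r O + 1)) by
    (apply Rdiv_lt_0_compat; [lra | generalize (H0 O); lra]).
  destruct (pow_lt_1_zero (1 / 2) Hlt _ He') as [N HN]; exists N.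
  specialize (HN N (le_n N)).
  rewrite Rabs_right in HN by (apply Rle_ge, pow_le; lra).
  assert (G := geometric_le r Hr O N); simpl in G.
  apply Rmult_lt_compat_l with (r := r O + 1) in HN; [|generalize (H0 O); lra].
  replace ((r O + 1) * (eps / (r O + 1))) with eps in HN
    by (field; generalize (H0 O); lra).
  assert (0 <= (1 / 2) ^ N) by (apply pow_le; lra).
  lra. }
destruct (V_complete (filtermap a eventually)) as [l Hl].
- apply filtermap_proper_filter, eventually_filter.
- intros eps; destruct (Hsmall (eps / 2)) as [N HN].
  { generalize (cond_pos eps); lra. }
  exists (a N), N; intros k Hk; apply norm_compat1.
  replace k with (N + (k - N))%nat by lia.
  generalize (Hd N (k - N)%nat) (H0 (N + (k - N))%nat); lra.
- exists l; intros k.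
  apply le_epsilon; intros eps He.
  assert (HL : locally l (fun y => norm (minus y l) < eps)).
  { apply locally_norm_iff; exists eps; auto. }
  destruct HL as [e HL].
  destruct (Hl e) as [N HN].
  specialize (HN (k + N)%nat ltac:(lia)).
  apply HL in HN.
  eapply Rle_trans; [apply (norm_minus_triangle _ (a (k + N)%nat))|].
  rewrite (norm_minus_sym l).
  generalize (Hd k N) (H0 (k + N)%nat); lra.
Qed.

Lemma continuous_ex_RInt : forall (f : R -> V) (a b : R),
  (forall t, continuous f t) -> ex_RInt f a b.
Proof.
pattern V; apply complete_ind; [|exact (fun _ _ _ H => H)|exact V_complete].
intros W f a b Hf; apply ex_RInt_continuous; auto.
Qed.

Lemma fundamental_theorem : forall (f df : R -> V) (a b : R),
  (forall t, is_derive f t (df t)) -> (forall t, continuous df t) ->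
  is_RInt df a b (minus (f b) (f a)).
Proof.
pattern V; apply complete_ind; [| |exact V_complete].
- intros W f df a b Hf Hc; apply (is_RInt_derive f df); auto.
- intros T c T' H f df a b Hf Hc; apply (H f df); [|exact Hc].
  intros t; exact (conj (is_linear_scal_l _) (proj2 (Hf t))).
Qed.

Lemma is_RInt_unicity : forall (f : R -> V) (a b : R) (l1 l2 : V),
  is_RInt f a b l1 -> is_RInt f a b l2 -> l1 = l2.
Proof.
pattern V; apply complete_ind; [|exact (fun _ _ _ H => H)|exact V_complete].
intros W f a b l1 l2 H1 H2.
apply (is_RInt_unique (V := W)) in H1; apply (is_RInt_unique (V := W)) in H2.
now rewrite <- H1, <- H2.
Qed.

End BanachSpace.

(** * Zabreiko's lemma *)

(** Dependent choice. The successor function is chosen on all pairs (index, element), with the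
    element itself as default where [P] fails, and is then iterated. *)
Lemma recursive_sequence {T : Type} (P : nat -> T -> Prop)
    (Q : nat -> T -> T -> Prop) (t0 : T) :
  P O t0 ->
  (forall k t, P k t -> exists t', P (S k) t' /\ Q k t t') ->
  exists s : nat -> T, s O = t0 /\ forall k, P k (s k) /\ Q k (s k) (s (S k)).
Proof.
intros H0 HS.
destruct (choice (fun (p : nat * T) t' =>
  P (fst p) (snd p) -> P (S (fst p)) t' /\ Q (fst p) (snd p) t')) as [F HF].
{ intros [k t]; simpl.
  destruct (classic (P k t)) as [H|H].
  - destruct (HS k t H) as [t' Ht']; exists t'; auto.
  - exists t; tauto. }
set (s := nat_rect (fun _ => T) t0 (fun k t => F (k, t))).
assert (HP : forall k, P k (s k)).
{ induction k as [|k IH]; [exact H0 | exact (proj1 (HF (k, s k) IH))]. }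
exists s; split; [reflexivity|].
intros k; split; [apply HP | exact (proj2 (HF (k, s k) (HP k)))].
Qed.

Lemma archimedean_nat (x : R) : exists n : nat, x <= INR n.
Proof.
destruct (INR_unbounded x) as [n Hn]; exists n; lra.
Qed.

Section Zabreiko.

Context {V : NormedModule R_AbsRing}.
Hypothesis V_complete : filter_complete V.
Variable p : V -> R.
Hypothesis p_plus : forall u v, p (plus u v) <= p u + p v.
Hypothesis p_scal : forall (r : R) u, p (scal r u) <= Rabs r * p u.
Variable K : R.
(** Countable subadditivity for series with geometrically decreasing terms; [K] absorbs the sum of
    the weights. *)
Hypothesis p_series : forall (s : nat -> V) (v : V) (C C' : R),
  s O = zero ->
  (forall k, p (minus (s (S k)) (s k)) <= C * (1 / 2) ^ k) ->
  (forall k, norm (minus v (s k)) <= C' * (1 / 2) ^ k) ->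
  p v <= K * C.

(** Baire's argument: if no sublevel set of [p] were dense in a ball, nested balls could avoid these
    sets one after another, and [p] would exceed every integer at their common point. *)
Lemma seminorm_ball_dense : exists (k : nat) (a : V) (r : R), 0 < r /\
  forall b, norm (minus b a) < r ->
  forall eps, 0 < eps -> exists u, p u <= INR k /\ norm (minus u b) < eps.
Proof.
apply NNPP; intros H.
destruct (recursive_sequence (T := V * R) (fun _ t => 0 < snd t)
  (fun k t t' => norm (minus (fst t') (fst t)) <= snd t /\ snd t' <= snd t / 2 /\
     forall u, p u <= INR k -> 2 * snd t' < norm (minus u (fst t'))) (zero, 1))
  as [s [_ Hs]].
- simpl; lra.
- simpl; intros k [a r] Hr; simpl in *.
  apply NNPP; intros Hn; apply H; exists k, a, r; split; [exact Hr|].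
  intros b Hb eps Heps; apply NNPP; intros Hu; apply Hn.
  (* With [eps / 4], even the ball of twice the new radius misses the sublevel set; [nested_limit]
     places the limit in that doubled ball. *)
  exists (b, Rmin (r / 2) (eps / 4)); simpl.
  assert (H1 := Rmin_l (r / 2) (eps / 4)).
  assert (H2 := Rmin_r (r / 2) (eps / 4)).
  split; [apply Rmin_glb_lt; lra|].
  split; [lra|]; split; [lra|].
  intros u Hpu; apply Rnot_le_lt; intros Hle; apply Hu.
  exists u; split; [exact Hpu | lra].
- destruct (nested_limit V_complete (fun k => fst (s k)) (fun k => snd (s k)))
    as [l Hl].
  + intros k; apply (Hs k).
  + intros k; apply (Hs k).
  + destruct (archimedean_nat (p l)) as [k Hk].
    destruct (Hs k) as [_ [_ [_ Hk']]].
    specialize (Hk' l Hk); specialize (Hl (S k)); simpl in Hl; lra.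
Qed.

(** Density around [a] is moved to the origin by differences: approximations of [a + b / t] and of
    [a] differ by an approximation of [b / t], which is then rescaled by [t]. *)
Lemma seminorm_ball0_dense : exists M r : R, 0 < M /\ 0 < r /\
  forall t b, 0 < t -> norm b < r * t ->
  forall eps, 0 < eps -> exists u, p u <= M * t /\ norm (minus u b) < eps.
Proof.
destruct seminorm_ball_dense as [k [a [r [Hr H]]]].
(* Each of the two approximations contributes [INR k]; the [+ 1] makes the constant positive. *)
exists (2 * INR k + 1), r.
split; [generalize (pos_INR k); lra|]; split; [exact Hr|].
intros t b Ht Hb eps Heps.
assert (Heps' : 0 < eps / t / 2) by (repeat apply Rdiv_lt_0_compat; lra).
assert (Hi : 0 < / t) by now apply Rinv_0_lt_compat.
destruct (H (plus a (scal (/ t) b))) with (eps := eps / t / 2) as [u1 [P1 N1]].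
{ replace (minus (plus a (scal (/ t) b)) a) with (scal (/ t) b) by module_eq V.
  rewrite norm_scal_real, Rabs_right by lra.
  apply Rmult_lt_reg_l with t; [exact Ht|].
  rewrite <- Rmult_assoc, Rinv_r; lra. }
{ exact Heps'. }
destruct (H a) with (eps := eps / t / 2) as [u2 [P2 N2]].
{ rewrite norm_minus_self; exact Hr. }
{ exact Heps'. }
exists (scal t (minus u1 u2)); split.
- eapply Rle_trans; [apply p_scal|]; rewrite Rabs_right by lra.
  rewrite (Rmult_comm _ t); apply Rmult_le_compat_l; [lra|].
  eapply Rle_trans; [apply p_plus|].
  replace (opp u2) with (scal (-1) u2) by module_eq V.
  generalize (p_scal (-1) u2); rewrite Rabs_left by lra; lra.
- norm_as (scal t (minus (minus u1 (plus a (scal (/ t) b))) (minus u2 a))).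
  rewrite norm_scal_real, Rabs_right by lra.
  assert (norm (minus (minus u1 (plus a (scal (/ t) b))) (minus u2 a)) < eps / t).
  { eapply Rle_lt_trans; [apply norm_triangle|]; rewrite norm_opp; lra. }
  replace eps with (t * (eps / t)) by (field; lra).
  now apply Rmult_lt_compat_l.
Qed.

(** A vector is expanded in a series by successive approximation: each term leaves a remainder
    within half the previous bound, while [p] of the terms decreases geometrically, so [p_series]
    applies. *)
Theorem countably_subadditive_bounded : exists C, 0 < C /\ forall v, p v <= C * norm v.
Proof.
destruct seminorm_ball0_dense as [M [r [HM [Hr H]]]].
assert (B : forall t v, 0 < t -> norm v < r * t -> p v <= K * (M * t)).
{ intros t v Ht Hv.
  destruct (recursive_sequence
    (fun k s => norm (minus v s) < r * (t * (1 / 2) ^ k))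
    (fun k s s' => p (minus s' s) <= M * (t * (1 / 2) ^ k)) zero) as [s [Hs0 Hs]].
  - rewrite pow_O; norm_as v; lra.
  - intros k s Hs.
    assert (Hk : 0 < t * (1 / 2) ^ k) by (apply Rmult_lt_0_compat; [lra | apply pow_lt; lra]).
    destruct (H (t * (1 / 2) ^ k) (minus v s) Hk Hs (r * (t * (1 / 2) ^ S k)))
      as [u [Pu Nu]].
    { simpl; assert (0 < r * (t * (1 / 2) ^ k)) by now apply Rmult_lt_0_compat. lra. }
    exists (plus s u); split.
    + rewrite norm_minus_sym.
      replace (minus (plus s u) v) with (minus u (minus v s)) by module_eq V.
      exact Nu.
    + replace (minus (plus s u) s) with u by module_eq V; exact Pu.
  - apply (p_series s v (M * t) (r * t)); [exact Hs0| |]; intros k.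
    + rewrite Rmult_assoc; apply (Hs k).
    + rewrite Rmult_assoc; left; apply (Hs k). }
assert (HK : 0 <= Rabs K) by apply Rabs_pos.
exists (Rabs K * M * (2 / r) + 1); split.
{ assert (0 <= Rabs K * M * (2 / r)); [|lra].
  apply Rmult_le_pos; [apply Rmult_le_pos; lra|].
  left; apply Rdiv_lt_0_compat; lra. }
intros v; destruct (norm_ge_0 v) as [Hv|Hv].
(* With this scale [r * t] is [2 * norm v], which is strictly above [norm v]. *)
- eapply Rle_trans; [apply (B (2 / r * norm v))|].
  + apply Rmult_lt_0_compat; [apply Rdiv_lt_0_compat; lra | exact Hv].
  + replace (r * (2 / r * norm v)) with (2 * norm v) by (field; lra); lra.
  + apply Rle_trans with (Rabs K * (M * (2 / r * norm v))); [|lra].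
    apply Rmult_le_compat_r; [|apply Rle_abs].
    apply Rmult_le_pos; [lra|]; apply Rmult_le_pos; [|lra].
    left; apply Rdiv_lt_0_compat; lra.
- assert (E := norm_eq_zero v (eq_sym Hv)); rewrite E, norm_zero.
  replace (zero : V) with (scal 0 v) by module_eq V.
  eapply Rle_trans; [apply p_scal|]; rewrite Rabs_R0; lra.
Qed.

End Zabreiko.

(** * Primitives of differentiable 1-forms over the reals *)

Lemma continuous_norm {V : NormedModule R_AbsRing} (f : R -> V) (t : R) :
  (forall eps, 0 < eps -> exists d, 0 < d /\
     forall s, Rabs (s - t) < d -> norm (minus (f s) (f t)) < eps) ->
  continuous f t.
Proof.
intros H P HP.
destruct (proj1 (locally_norm_iff _ _) HP) as [eps [He HPe]].
destruct (H eps He) as [d [Hd Hf]].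
exists (mkposreal d Hd); intros s Hs; apply HPe, Hf, Hs.
Qed.

(** [filterdiff] ranges over all limits of the filter, and [x] is the only limit of [locally x]. *)
Lemma filterdiff_norm_iff {K : AbsRing} {U V : NormedModule K} (f l : U -> V) (x : U) :
  filterdiff f (locally x) l <->
  is_linear l /\ forall eps : posreal, locally x (fun y =>
    norm (minus (minus (f y) (f x)) (l (minus y x))) <= eps * norm (minus y x)).
Proof.
split.
- intros [Hl H]; split; [exact Hl | exact (H x (fun P HP => HP))].
- intros [Hl H]; split; [exact Hl|].
  intros x' Hx'; rewrite (is_filter_lim_locally_unique _ _ Hx') in H.
  rewrite (is_filter_lim_locally_unique _ _ Hx') ; exact H.
Qed.

Lemma linear_opp_comm {U V : NormedModule R_AbsRing} (l : U -> V) :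
  is_linear l -> forall x, l (opp x) = opp (l x).
Proof.
intros Hl x.
replace (opp x) with (scal (-1) x) by module_eq U.
rewrite (linear_scal l Hl); module_eq V.
Qed.

Lemma linear_minus {U V : NormedModule R_AbsRing} (l : U -> V) :
  is_linear l -> forall x y, l (minus x y) = minus (l x) (l y).
Proof.
intros Hl x y; unfold minus.
now rewrite (linear_plus l Hl), linear_opp_comm.
Qed.

(** Provides the primitive needed to integrate the first-order expansion of a form along a segment,
    which is affine in the parameter. *)
Lemma quadratic_derive {V : NormedModule R_AbsRing} (p q : V) (t : R) :
  is_derive (fun t : R => plus (scal t p) (scal (t * t / 2) q)) t (plus p (scal t q)).
Proof.
assert (H1 : is_derive (fun t : R => t) t 1) by apply (is_derive_id (K := R_AbsRing)).
assert (H2 : is_derive (fun t : R => t * t / 2) t t)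
  by (auto_derive; [exact I | field]).
assert (E : p = scal 1 p) by module_eq V.
assert (H := is_derive_plus _ _ _ _ _ (is_derive_scal_l _ _ _ p H1)
               (is_derive_scal_l _ _ _ q H2)).
refine (eq_ind _ (fun l : V => is_derive _ t l) H _ _).
exact (f_equal (fun z : V => plus z (scal t q)) (eq_sym E)).
Qed.

Section Primitive.

Context {A B : NormedModule R_AbsRing}.
Hypothesis A_complete : filter_complete A.
Hypothesis B_complete : filter_complete B.
(** [dg x h] is the derivative of the form [g] at [x] in the direction [h]. Linear maps are plain
    functions here, so estimates in operator norm are written out on every argument. *)
Variable g : A -> A -> B.
Variable dg : A -> A -> A -> B.
Hypothesis g_linear : forall x, is_linear (g x).
Hypothesis dg_linear_l : forall x k, is_linear (fun h => dg x h k).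
Hypothesis dg_linear_r : forall x h, is_linear (dg x h).
Hypothesis dg_bounded : forall x, exists M, 0 < M /\
  forall h k, norm (dg x h k) <= M * norm h * norm k.
Hypothesis g_diff : forall (x : A) (eps : R), 0 < eps -> exists d, 0 < d /\
  forall y : A, norm (minus y x) < d -> forall h : A,
  norm (minus (minus (g y h) (g x h)) (dg x (minus y x) h))
    <= eps * norm (minus y x) * norm h.

(** * Integrals along segments and their first-order expansion *)

Lemma g_continuous (x : A) (eps : R) : 0 < eps -> exists d, 0 < d /\
  forall y : A, norm (minus y x) < d -> forall h : A,
  norm (minus (g y h) (g x h)) <= eps * norm h.
Proof.
intros Heps.
destruct (g_diff x 1 Rlt_0_1) as [d [Hd H]].
destruct (dg_bounded x) as [M [HM HMb]].
assert (Hp : 0 < eps / (1 + M)) by (apply Rdiv_lt_0_compat; lra).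
exists (Rmin d (eps / (1 + M))); split; [now apply Rmin_glb_lt|].
intros y Hy h.
assert (Hy1 := Rlt_le_trans _ _ _ Hy (Rmin_l _ _)).
assert (Hy2 := Rlt_le_trans _ _ _ Hy (Rmin_r _ _)).
norm_as (plus (minus (minus (g y h) (g x h)) (dg x (minus y x) h)) (dg x (minus y x) h)).
eapply Rle_trans; [apply norm_triangle|].
specialize (H y Hy1 h); specialize (HMb (minus y x) h).
apply Rle_trans with ((1 + M) * norm (minus y x) * norm h); [lra|].
apply Rmult_le_compat_r; [apply norm_ge_0|].
apply Rmult_lt_compat_l with (r := 1 + M) in Hy2; [|lra].
replace ((1 + M) * (eps / (1 + M))) with eps in Hy2 by (field; lra); lra.
Qed.

Lemma line_continuous (a w : A) (t : R) :
  continuous (fun t : R => g (plus a (scal t w)) w) t.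
Proof.
apply continuous_norm; intros eps Heps.
assert (H1 := norm_ge_0 w).
assert (He : 0 < eps / (norm w + 1)) by (apply Rdiv_lt_0_compat; lra).
destruct (g_continuous (plus a (scal t w)) _ He) as [d [Hd H]].
exists (d / (norm w + 1)); split; [apply Rdiv_lt_0_compat; lra|].
intros s Hs; eapply Rle_lt_trans; [apply H|].
- norm_as (scal (s - t) w); rewrite norm_scal_real.
  apply Rmult_lt_compat_r with (r := norm w + 1) in Hs; [|lra].
  replace (d / (norm w + 1) * (norm w + 1)) with d in Hs by (field; lra).
  generalize (Rabs_pos (s - t)); lra.
- assert (E : eps / (norm w + 1) * (norm w + 1) = eps) by (field; lra); lra.
Qed.

Lemma line_integral_exists : exists S : A -> A -> B, forall a b : A,
  is_RInt (fun t : R => g (plus a (scal t (minus b a))) (minus b a)) 0 1 (S a b).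
Proof.
destruct (choice (fun (p : A * A) l =>
  is_RInt (fun t : R => g (plus (fst p) (scal t (minus (snd p) (fst p))))
                      (minus (snd p) (fst p))) 0 1 l)) as [S HS].
- intros [a b]; simpl; apply (continuous_ex_RInt B_complete).
  apply line_continuous.
- exists (fun a b => S (a, b)); intros a b; apply (HS (a, b)).
Qed.

Section LineIntegral.

Variable S : A -> A -> B.
Hypothesis S_spec : forall a b : A,
  is_RInt (fun t : R => g (plus a (scal t (minus b a))) (minus b a)) 0 1 (S a b).

(** An affine change of parameter carries the unit interval to the one from [s] to [t]. The order of
    [s] and [t] is free, which also gives the reversal of segments. *)
Lemma line_sub (a w : A) (s t : R) :
  is_RInt (fun t : R => g (plus a (scal t w)) w) s t
    (S (plus a (scal s w)) (plus a (scal t w))).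
Proof.
destruct (continuous_ex_RInt B_complete (fun t : R => g (plus a (scal t w)) w) s t)
  as [l Hl].
{ apply line_continuous. }
replace (S (plus a (scal s w)) (plus a (scal t w))) with l; [exact Hl|].
apply (is_RInt_unicity B_complete) with (2 := S_spec _ _).
assert (Hc := is_RInt_comp_lin (fun t : R => g (plus a (scal t w)) w) (t - s) s 0 1 l).
replace ((t - s) * 0 + s) with s in Hc by ring.
replace ((t - s) * 1 + s) with t in Hc by ring.
apply is_RInt_ext with (2 := Hc Hl); intros r _.
rewrite <- (linear_scal _ (g_linear _)); f_equal; module_eq A.
Qed.

Lemma line_split (a b : A) (s : R) :
  S a b = plus (S a (plus a (scal s (minus b a)))) (S (plus a (scal s (minus b a))) b).
Proof.
assert (H1 := line_sub a (minus b a) 0 s).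
assert (H2 := line_sub a (minus b a) s 1).
replace (plus a (scal 0 (minus b a))) with a in H1 by module_eq A.
replace (plus a (scal 1 (minus b a))) with b in H2 by module_eq A.
exact (is_RInt_unicity B_complete _ _ _ _ _ (S_spec a b) (is_RInt_Chasles _ _ _ _ _ _ H1 H2)).
Qed.

Lemma line_swap (a b : A) : S b a = opp (S a b).
Proof.
assert (H1 := line_sub a (minus b a) 1 0).
assert (H2 := is_RInt_swap _ _ _ _ (S_spec a b)).
replace (plus a (scal 0 (minus b a))) with a in H1 by module_eq A.
replace (plus a (scal 1 (minus b a))) with b in H1 by module_eq A.
exact (is_RInt_unicity B_complete _ _ _ _ _ H1 H2).
Qed.

Lemma line_primitive (f : A -> B) :
  (forall x, filterdiff f (locally x) (g x)) -> forall a b, S a b = minus (f b) (f a).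
Proof.
intros Hf a b; set (w := (minus b a : A)).
assert (H : is_RInt (fun t : R => g (plus a (scal t w)) w) 0 1
  (minus (f (plus a (scal 1 w))) (f (plus a (scal 0 w))))).
{ apply (fundamental_theorem B_complete (fun t : R => f (plus a (scal t w)))).
  - intros t.
    assert (Hl : filterdiff (fun t : R => plus a (scal t w)) (locally t)
               (fun y : R => scal y w)).
    { apply (proj2 (filterdiff_norm_iff (U := AbsRing_NormedModule R_AbsRing)
        (fun t : R => plus a (scal t w)) (fun y : R => scal y w) t)); split;
        [exact (is_linear_scal_l (K := R_AbsRing) w)|].
      intros eps; exists eps; intros y _.
      (* The path is affine, so the remainder of its expansion is zero. *)
      change (minus y t) with (y - t); norm_as (zero : A).
      apply Rle_trans with 0; [right; apply (norm_zero (V := A))|].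
      apply Rmult_le_pos; [left; apply cond_pos | apply Rabs_pos]. }
    apply filterdiff_ext_lin with (1 := filterdiff_comp' _ f t _ _ Hl (Hf _)).
    intros y; apply (linear_scal _ (g_linear _)).
  - apply line_continuous. }
replace (plus a (scal 0 w)) with a in H by module_eq A.
replace (plus a (scal 1 w)) with b in H by (unfold w; module_eq A).
exact (is_RInt_unicity B_complete _ _ _ _ _ (S_spec a b) H).
Qed.

Lemma line_close (a b : A) (eps : R) :
  (forall t, 0 <= t <= 1 ->
     norm (minus (g (plus a (scal t (minus b a))) (minus b a)) (g a (minus b a))) <= eps) ->
  norm (minus (S a b) (g a (minus b a))) <= eps.
Proof.
intros H.
assert (Hc := is_RInt_const 0 1 (g a (minus b a))).
assert (HI := is_RInt_minus _ _ _ _ _ _ (S_spec a b) Hc).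
apply (norm_RInt_le_const _ 0 1 _ eps) in HI; [|lra|exact H].
replace (g a (minus b a)) with (scal (1 - 0) (g a (minus b a))) by module_eq B.
lra.
Qed.

(* If [dg x] is symmetric, [potential x] is a primitive of the first-order
   Taylor expansion of [g] at [x]. *)
Definition potential (x y : A) : B :=
  plus (g x (minus y x)) (scal (1 / 2) (dg x (minus y x) (minus y x))).

(** The exterior derivative of the 1-form [g] at [x]. *)
Definition curl (x u v : A) : B := minus (dg x u v) (dg x v u).

(** Along the segment, [g] is replaced by its expansion at [x] with error at most
    [eps * rho * norm w]. The integral of the expansion splits into a difference of potentials and
    an antisymmetric rest. *)
Lemma line_expansion (x a b : A) (eps rho : R) :
  0 <= eps ->
  (forall y, norm (minus y x) <= rho -> forall h,
     norm (minus (minus (g y h) (g x h)) (dg x (minus y x) h))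
       <= eps * norm (minus y x) * norm h) ->
  norm (minus a x) <= rho -> norm (minus b x) <= rho ->
  norm (minus (S a b)
     (plus (minus (potential x b) (potential x a))
           (scal (1 / 2) (curl x (minus a x) (minus b x)))))
    <= eps * rho * norm (minus b a).
Proof.
intros Heps Hg Ha Hb.
set (w := (minus b a : A)).
(* [p + t q] is the expansion of [g] at [x], taken at the point of parameter [t] and applied to
   [w]. *)
set (p := plus (g x w) (dg x (minus a x) w)); set (q := dg x w w).
assert (HP : is_RInt (fun t : R => plus p (scal t q)) 0 1
  (minus (plus (scal 1 p) (scal (1 * 1 / 2) q)) (plus (scal 0 p) (scal (0 * 0 / 2) q)))).
{ apply (fundamental_theorem B_complete
    (fun t : R => plus (scal t p) (scal (t * t / 2) q))).
  - intros t.
    apply quadratic_derive.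
  - intros t; apply (continuous_plus (V := B)); [apply continuous_const|].
    apply (continuous_scal_l (fun t : R => t)); apply continuous_id. }
assert (HI := is_RInt_minus _ _ _ _ _ _ (S_spec a b) HP).
apply (norm_RInt_le_const _ 0 1 _ (eps * rho * norm w)) in HI; [|lra|].
- replace ((1 - 0) * (eps * rho * norm w)) with (eps * rho * norm w) in HI by ring.
  eapply Rle_trans; [|exact HI]; right; apply f_equal, f_equal.
  unfold potential, curl, p, q.
  replace w with (minus (minus b x) (minus a x)) by (unfold w; module_eq A).
  generalize (minus b x) (minus a x); intros v u.
  rewrite !(linear_minus _ (g_linear x)), !(linear_minus _ (dg_linear_r x _)).
  rewrite !(linear_minus _ (dg_linear_l x _)).
  module_eq B.
- intros t Ht; fold w.
  (* The ball around [x] is convex, so it contains the segment. *)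
  assert (Hn : norm (minus (plus a (scal t w)) x) <= rho).
  { unfold w; norm_as (plus (scal (1 - t) (minus a x)) (scal t (minus b x))).
    eapply Rle_trans; [apply (norm_triangle (V := A))|].
    rewrite !norm_scal_real, !Rabs_right by lra.
    apply Rle_trans with ((1 - t) * rho + t * rho); [|lra].
    apply Rplus_le_compat; apply Rmult_le_compat_l; lra. }
  eapply Rle_trans; [|apply Rle_trans with (1 := Hg _ Hn w)].
  + right; apply f_equal; unfold p, q.
    replace (minus (plus a (scal t w)) x) with (plus (minus a x) (scal t w))
      by module_eq A.
    rewrite (linear_plus _ (dg_linear_l x w)), (linear_scal _ (dg_linear_l x w)).
    module_eq B.
  + apply Rmult_le_compat_r; [apply norm_ge_0|].
    apply Rmult_le_compat_l; [exact Heps | exact Hn].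
Qed.

Definition circulation (a b c : A) : B := plus (plus (S a b) (S b c)) (S c a).

(** The potentials telescope around the triangle, and only the curl terms remain. *)
Lemma circulation_expansion (x a b c : A) (eps rho : R) :
  0 <= eps ->
  (forall y, norm (minus y x) <= rho -> forall h,
     norm (minus (minus (g y h) (g x h)) (dg x (minus y x) h))
       <= eps * norm (minus y x) * norm h) ->
  norm (minus a x) <= rho -> norm (minus b x) <= rho -> norm (minus c x) <= rho ->
  norm (minus (circulation a b c)
     (scal (1 / 2) (plus (plus (curl x (minus a x) (minus b x))
        (curl x (minus b x) (minus c x))) (curl x (minus c x) (minus a x)))))
    <= eps * rho * (norm (minus b a) + norm (minus c b) + norm (minus a c)).
Proof.
intros Heps Hg Ha Hb Hc.
assert (Hab := line_expansion x a b eps rho Heps Hg Ha Hb).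
assert (Hbc := line_expansion x b c eps rho Heps Hg Hb Hc).
assert (Hca := line_expansion x c a eps rho Heps Hg Hc Ha).
revert Hab Hbc Hca; unfold circulation.
generalize (curl x (minus a x) (minus b x)) (curl x (minus b x) (minus c x))
  (curl x (minus c x) (minus a x)) (potential x a) (potential x b) (potential x c).
intros c1 c2 c3 pa pb pc Hab Hbc Hca.
replace (eps * rho * (norm (minus b a) + norm (minus c b) + norm (minus a c)))
  with (eps * rho * norm (minus b a) + eps * rho * norm (minus c b)
        + eps * rho * norm (minus a c)) by ring.
norm_as (plus (plus (minus (S a b) (plus (minus pb pa) (scal (1 / 2) c1)))
  (minus (S b c) (plus (minus pc pb) (scal (1 / 2) c2))))
  (minus (S c a) (plus (minus pa pc) (scal (1 / 2) c3)))).
exact (norm_plus3_le _ _ _ _ _ _ Hab Hbc Hca).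
Qed.

Lemma g_diff_closed (x : A) (eps : R) : 0 < eps -> exists d, 0 < d /\
  forall rho y, rho < d -> norm (minus y x) <= rho -> forall h,
  norm (minus (minus (g y h) (g x h)) (dg x (minus y x) h))
    <= eps * norm (minus y x) * norm h.
Proof.
intros He; destruct (g_diff x eps He) as [d [Hd H]]; exists d; split; [exact Hd|].
intros rho y Hr Hy; apply H; lra.
Qed.

(** * Symmetry of the derivative of an integrable form *)

(** The triangle [x], [x + s h], [x + s k] has zero circulation, while its expansion is [s * s / 2]
    times the curl, up to an error of order [e * (s * s)]. The factor [s * s] cancels. *)
Lemma curl_bound (f : A -> B) (x h k : A) (eps : R) :
  (forall x, filterdiff f (locally x) (g x)) -> 0 < eps ->
  norm (curl x h k) <= eps.
Proof.
intros Hf Heps.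
set (N := norm h + norm k).
assert (HN : 0 <= N) by (generalize (norm_ge_0 h) (norm_ge_0 k); unfold N; lra).
(* The perimeter is at most [2 * (s * N)], so the curl will be bounded by [4 * (N * N) * e]; the
   [+ 1] keeps the denominator positive. *)
set (e := eps / (4 * (N * N) + 1)).
assert (HN2 : 0 <= N * N) by now apply Rmult_le_pos.
assert (He : 0 < e) by (apply Rdiv_lt_0_compat; lra).
destruct (g_diff_closed x e He) as [d [Hd Hg]].
set (s := d / 2 / (N + 1)).
assert (Hs : 0 < s) by (repeat apply Rdiv_lt_0_compat; lra).
assert (HsN : s * N < d).
{ apply Rle_lt_trans with (s * (N + 1)); [apply Rmult_le_compat_l; lra|].
  unfold s; field_simplify; lra. }
assert (H0 : norm (minus x x) <= s * N).
{ rewrite norm_minus_self; apply Rmult_le_pos; lra. }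
assert (Hh : norm (minus (plus x (scal s h)) x) = s * norm h).
{ norm_as (scal s h); rewrite norm_scal_real, Rabs_right; lra. }
assert (Hk : norm (minus (plus x (scal s k)) x) = s * norm k).
{ norm_as (scal s k); rewrite norm_scal_real, Rabs_right; lra. }
assert (Hhk : norm (minus (plus x (scal s k)) (plus x (scal s h))) <= s * N).
{ eapply Rle_trans; [apply (norm_minus_triangle _ x)|].
  rewrite (norm_minus_sym x), Hh, Hk; unfold N; lra. }
assert (H := circulation_expansion x x (plus x (scal s h)) (plus x (scal s k))
  e (s * N) (Rlt_le _ _ He) (fun y Hy => Hg _ y HsN Hy) H0).
rewrite Hh, Hk, (norm_minus_sym x), Hk in H.
assert (Hh' := norm_ge_0 h); assert (Hk' := norm_ge_0 k).
assert (Hsh : s * norm h <= s * N) by (apply Rmult_le_compat_l; unfold N; lra).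
assert (Hsk : s * norm k <= s * N) by (apply Rmult_le_compat_l; unfold N; lra).
specialize (H Hsh Hsk).
assert (Hc : norm (scal (s * s / 2) (curl x h k)) <= e * (s * N) * (2 * (s * N))).
{ eapply Rle_trans; [|eapply Rle_trans; [exact H|]].
  - right; rewrite <- norm_opp; apply f_equal.
    unfold circulation, curl; rewrite !(line_primitive f Hf).
    replace (minus x x) with (scal 0 h) by module_eq A.
    replace (minus (plus x (scal s h)) x) with (scal s h) by module_eq A.
    replace (minus (plus x (scal s k)) x) with (scal s k) by module_eq A.
    rewrite !(linear_scal _ (dg_linear_r x _)), !(linear_scal _ (dg_linear_l x _)).
    module_eq B.
  - apply Rmult_le_compat_l; [apply Rmult_le_pos; [lra | apply Rmult_le_pos; lra]|].
    unfold N in *; lra. }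
rewrite norm_scal_real, Rabs_right in Hc by (generalize (Rmult_lt_0_compat _ _ Hs Hs); lra).
apply Rle_trans with (e * (4 * (N * N))).
- apply Rmult_le_reg_l with (s * s / 2); [generalize (Rmult_lt_0_compat _ _ Hs Hs); lra|].
  eapply Rle_trans; [exact Hc|]; right; field.
- apply Rle_trans with (e * (4 * (N * N) + 1)); [apply Rmult_le_compat_l; lra|].
  right; unfold e; field; lra.
Qed.

Lemma integrable_curl_free (f : A -> B) :
  (forall x, filterdiff f (locally x) (g x)) ->
  forall x h k, dg x h k = dg x k h.
Proof.
intros Hf x h k.
assert (E : curl x h k = zero).
{ apply norm_eq_zero, Rle_antisym; [|apply norm_ge_0].
  apply le_epsilon; intros eps He; rewrite Rplus_0_l.
  now apply (curl_bound f). }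
unfold curl in E.
replace (dg x h k) with (plus (minus (dg x h k) (dg x k h)) (dg x k h)) by module_eq B.
rewrite E; apply plus_zero_l.
Qed.

(** * Goursat's argument and the construction of a primitive *)

Section CurlFree.

Hypothesis curl_free : forall x h k, dg x h k = dg x k h.

Lemma circulation_small (x a b c : A) (eps rho : R) :
  0 <= eps ->
  (forall y, norm (minus y x) <= rho -> forall h,
     norm (minus (minus (g y h) (g x h)) (dg x (minus y x) h))
       <= eps * norm (minus y x) * norm h) ->
  norm (minus a x) <= rho -> norm (minus b x) <= rho -> norm (minus c x) <= rho ->
  norm (circulation a b c)
    <= eps * rho * (norm (minus b a) + norm (minus c b) + norm (minus a c)).
Proof.
intros Heps Hg Ha Hb Hc.
assert (H := circulation_expansion x a b c eps rho Heps Hg Ha Hb Hc).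
unfold curl in H.
rewrite (curl_free x (minus a x) (minus b x)) in H.
rewrite (curl_free x (minus b x) (minus c x)) in H.
rewrite (curl_free x (minus c x) (minus a x)) in H.
eapply Rle_trans; [|exact H].
right; apply f_equal; module_eq B.
Qed.

Definition mid (a b : A) : A := scal (1 / 2) (plus a b).

Lemma mid_line (a b : A) : S a b = plus (S a (mid a b)) (S (mid a b) b).
Proof.
replace (mid a b) with (plus a (scal (1 / 2) (minus b a)))
  by (unfold mid; module_eq A).
apply line_split.
Qed.

(** The midpoints cut the triangle into four; each inner edge is traversed once in each direction
    and cancels. *)
Lemma circulation_split (a b c : A) :
  circulation a b c =
  plus (plus (circulation a (mid a b) (mid c a)) (circulation (mid a b) b (mid b c)))
       (plus (circulation (mid c a) (mid b c) c) (circulation (mid a b) (mid b c) (mid c a))).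
Proof.
unfold circulation.
rewrite (mid_line a b), (mid_line b c), (mid_line c a).
rewrite (line_swap (mid c a) (mid a b)), (line_swap (mid a b) (mid b c)),
  (line_swap (mid b c) (mid c a)).
module_eq B.
Qed.

Lemma quarter_bound (x1 x2 x3 x4 : B) (M : R) :
  M <= norm (plus (plus x1 x2) (plus x3 x4)) ->
  M / 4 <= norm x1 \/ M / 4 <= norm x2 \/ M / 4 <= norm x3 \/ M / 4 <= norm x4.
Proof.
intros H.
assert (H1 := norm_triangle (plus x1 x2) (plus x3 x4)).
assert (H2 := norm_triangle x1 x2); assert (H3 := norm_triangle x3 x4).
destruct (Rle_dec (M / 4) (norm x1)); [tauto|].
destruct (Rle_dec (M / 4) (norm x2)); [tauto|].
destruct (Rle_dec (M / 4) (norm x3)); [tauto|].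
destruct (Rle_dec (M / 4) (norm x4)); [tauto|].
exfalso; cut (norm (plus (plus x1 x2) (plus x3 x4)) < M); [lra|].
eapply Rle_lt_trans; [exact H1|].
eapply Rle_lt_trans; [apply Rplus_le_compat; [exact H2 | exact H3]|]; lra.
Qed.

Lemma half_side (u v w z : A) (d : R) :
  minus v u = scal (1 / 2) (minus w z) -> norm (minus w z) <= d ->
  norm (minus v u) <= d / 2.
Proof.
intros E H.
assert (E' : norm (minus v u) = norm (scal (1 / 2) (minus w z))) by (now rewrite E).
rewrite E', norm_scal_real, Rabs_right; lra.
Qed.

Definition sides_le (d : R) (T : A * A * A) : Prop :=
  let '(a, b, c) := T in
  norm (minus b a) <= d /\ norm (minus c b) <= d /\ norm (minus a c) <= d.

(** One of the four pieces carries at least a quarter of the circulation. The bound on the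
    displacement of the first vertex makes these vertices converge under iteration. *)
Lemma subdivision (a b c : A) (d M : R) :
  sides_le d (a, b, c) -> M <= norm (circulation a b c) ->
  exists a' b' c' : A, sides_le (d / 2) (a', b', c') /\
    M / 4 <= norm (circulation a' b' c') /\ norm (minus a' a) <= d.
Proof.
intros [Hab [Hbc Hca]] HM.
rewrite circulation_split in HM; apply quarter_bound in HM.
assert (Hd : 0 <= d) by exact (Rle_trans _ _ _ (norm_ge_0 _) Hab).
assert (Hba := Hab); rewrite norm_minus_sym in Hba.
assert (Hcb := Hbc); rewrite norm_minus_sym in Hcb.
assert (Hac := Hca); rewrite norm_minus_sym in Hac.
assert (H0 : norm (minus a a) <= d) by (rewrite norm_minus_self; lra).
assert (Hm1 : norm (minus (mid a b) a) <= d).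
{ apply Rle_trans with (d / 2); [|lra].
  apply (half_side _ _ b a); [unfold mid; module_eq A | exact Hab]. }
assert (Hm2 : norm (minus (mid c a) a) <= d).
{ apply Rle_trans with (d / 2); [|lra].
  apply (half_side _ _ c a); [unfold mid; module_eq A | exact Hac]. }
destruct HM as [H|[H|[H|H]]]; [exists a, (mid a b), (mid c a)
  | exists (mid a b), b, (mid b c) | exists (mid c a), (mid b c), c
  | exists (mid a b), (mid b c), (mid c a)]; (split; [|now split]);
unfold sides_le; repeat split;
(* Each side of a piece is half of an original side, up to direction; the alternatives are tried
   until the vector identity holds. *)
first [ apply (half_side _ _ b a); [unfold mid; module_eq A; fail | exact Hab]
      | apply (half_side _ _ a b); [unfold mid; module_eq A; fail | exact Hba]
      | apply (half_side _ _ c b); [unfold mid; module_eq A; fail | exact Hbc]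
      | apply (half_side _ _ b c); [unfold mid; module_eq A; fail | exact Hcb]
      | apply (half_side _ _ a c); [unfold mid; module_eq A; fail | exact Hca]
      | apply (half_side _ _ c a); [unfold mid; module_eq A; fail | exact Hac] ].
Qed.

(* Goursat's bisection: only pointwise differentiability of [g] is available,
   so one cannot differentiate under the integral sign. *)
Lemma circulation_zero (a b c : A) : circulation a b c = zero.
Proof.
set (M := norm (circulation a b c)).
set (d := norm (minus b a) + norm (minus c b) + norm (minus a c)).
assert (Hba := norm_ge_0 (minus b a)); assert (Hcb := norm_ge_0 (minus c b)).
assert (Hac := norm_ge_0 (minus a c)).
assert (Hd : 0 <= d) by (unfold d; lra).
destruct (recursive_sequence (T := A * A * A)
  (fun k T => sides_le (d * (1 / 2) ^ k) T /\
     M * (1 / 4) ^ k <= norm (circulation (fst (fst T)) (snd (fst T)) (snd T)))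
  (fun k T T' => norm (minus (fst (fst T')) (fst (fst T))) <= d * (1 / 2) ^ k)
  (a, b, c)) as [s [_ Hs]].
- simpl; unfold d; fold M; repeat split; lra.
- intros k [[a1 b1] c1] [H1 H2]; simpl in H2.
  destruct (subdivision a1 b1 c1 _ _ H1 H2) as [a2 [b2 [c2 [H3 [H4 H5]]]]].
  exists (a2, b2, c2); simpl fst; simpl snd.
  replace (d * (1 / 2) ^ Datatypes.S k) with (d * (1 / 2) ^ k / 2) by (simpl; field).
  replace (M * (1 / 4) ^ Datatypes.S k) with (M * (1 / 4) ^ k / 4) by (simpl; field).
  auto.
- destruct (nested_limit A_complete (fun k => fst (fst (s k)))
    (fun k => d * (1 / 2) ^ k)) as [x Hx].
  { intros k; apply Hs. }
  { intros k; simpl; lra. }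
  apply norm_eq_zero, Rle_antisym; [|apply norm_ge_0]; fold M.
  apply le_epsilon; intros eps Heps; rewrite Rplus_0_l.
  assert (Hd2 : 0 <= d * d) by now apply Rmult_le_pos.
  (* At stage [k], with [q] for [(1 / 2) ^ k], the vertices lie within [3 * (d * q)] of the limit
     [x] and the perimeter is at most [3 * (d * q)]. The circulation is thus at most
     [9 * (d * d) * e * (q * q)] and at least [M * (q * q)]. *)
  set (e := eps / (9 * (d * d) + 1)).
  assert (He : 0 < e) by (apply Rdiv_lt_0_compat; lra).
  destruct (g_diff_closed x e He) as [r [Hr Hg]].
  assert (Hlt : Rabs (1 / 2) < 1) by (rewrite Rabs_right; lra).
  assert (Hr' : 0 < r / (3 * d + 1)) by (apply Rdiv_lt_0_compat; lra).
  destruct (pow_lt_1_zero (1 / 2) Hlt _ Hr') as [k Hk].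
  specialize (Hk k (le_n k)); rewrite Rabs_right in Hk by (apply Rle_ge, pow_le; lra).
  assert (Hq : 0 < (1 / 2) ^ k) by (apply pow_lt; lra).
  specialize (Hx k); destruct (Hs k) as [[H1 H2] _]; revert Hx H1 H2.
  destruct (s k) as [[a1 b1] c1]; simpl; intros Hx [H1 [H2 H3]] H4.
  assert (E4 : (1 / 4) ^ k = (1 / 2) ^ k * (1 / 2) ^ k).
  { rewrite <- Rpow_mult_distr; f_equal; field. }
  rewrite E4 in H4.
  revert Hk Hq Hx H1 H2 H3 H4 E4; generalize ((1 / 2) ^ k); intros q Hk Hq Hx H1 H2 H3 H4 _.
  assert (Hrho : 3 * (d * q) < r).
  { apply Rmult_lt_compat_l with (r := 3 * d + 1) in Hk; [|lra].
    replace ((3 * d + 1) * (r / (3 * d + 1))) with r in Hk by (field; lra); lra. }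
  assert (Hdq : 0 <= d * q) by (apply Rmult_le_pos; lra).
  rewrite norm_minus_sym in Hx.
  assert (Ha : norm (minus a1 x) <= 3 * (d * q)) by lra.
  assert (Hb : norm (minus b1 x) <= 3 * (d * q)).
  { eapply Rle_trans; [apply (norm_minus_triangle _ a1)|]; lra. }
  assert (Hc : norm (minus c1 x) <= 3 * (d * q)).
  { eapply Rle_trans; [apply (norm_minus_triangle _ a1)|].
    rewrite (norm_minus_sym c1 a1); lra. }
  assert (H := circulation_small x a1 b1 c1 e _ (Rlt_le _ _ He)
    (fun y Hy => Hg _ y Hrho Hy) Ha Hb Hc).
  assert (H' : M * (q * q) <= e * (9 * (d * d)) * (q * q)).
  { eapply Rle_trans; [exact H4|]; eapply Rle_trans; [exact H|].
    apply Rle_trans with (e * (3 * (d * q)) * (3 * (d * q))); [|right; ring].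
    apply Rmult_le_compat_l; [apply Rmult_le_pos; lra | lra]. }
  apply Rmult_le_reg_r in H'; [|now apply Rmult_lt_0_compat].
  eapply Rle_trans; [exact H'|].
  apply Rle_trans with (e * (9 * (d * d) + 1)); [apply Rmult_le_compat_l; lra|].
  right; unfold e; field; lra.
Qed.

(** Zero circulation around the origin, [x] and [y] turns the increment of [S zero] into [S x y],
    which continuity of [g] compares with [g x (y - x)]. *)
Lemma line_integral_primitive (x : A) : filterdiff (S zero) (locally x) (g x).
Proof.
apply filterdiff_norm_iff; split; [apply g_linear|].
intros eps; apply locally_norm_iff.
destruct (g_continuous x eps (cond_pos eps)) as [d [Hd H]].
exists d; split; [exact Hd|]; intros y Hy.
assert (E : minus (S zero y) (S zero x) = S x y).
{ assert (Hc := circulation_zero zero x y); unfold circulation in Hc.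
  rewrite (line_swap zero y) in Hc.
  replace (S x y) with
    (minus (plus (plus (S zero x) (S x y)) (opp (S zero y)))
           (minus (S zero x) (S zero y))) by module_eq B.
  rewrite Hc; module_eq B. }
rewrite E; apply line_close; intros t Ht; apply H.
norm_as (scal t (minus y x)); rewrite norm_scal_real, Rabs_right by lra.
apply Rle_lt_trans with (1 * norm (minus y x)); [|lra].
apply Rmult_le_compat_r; [apply norm_ge_0 | lra].
Qed.

End CurlFree.

End LineIntegral.

Theorem integrable_iff_symmetric :
  (exists f : A -> B, forall x, filterdiff f (locally x) (g x)) <->
  (forall x h k, dg x h k = dg x k h).
Proof.
destruct line_integral_exists as [S HS]; split.
- intros [f Hf]; exact (integrable_curl_free S HS f Hf).
- intros H; exists (S zero); exact (line_integral_primitive S HS H).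
Qed.

End Primitive.

(** * Restriction of scalars and coordinates *)

Lemma minus_plus_cancel {G : AbelianGroup} (a b : G) : plus (minus a b) b = a.
Proof. unfold minus; now rewrite <- plus_assoc, plus_opp_l, plus_zero_r. Qed.

Lemma minus_zero_eq {G : AbelianGroup} (a b : G) : minus a b = zero -> a = b.
Proof. intros H; now rewrite <- (minus_plus_cancel a b), H, plus_zero_l. Qed.

Section RealModule.

Context {D : RealBanachRing}.

(* Only the scalar multiplication changes: norm and uniform structure are those
   of [V], so limits and [o]-estimates transfer by conversion. *)
Definition real_ModuleSpace_mixin (V : NormedModule D) :
  ModuleSpace.mixin_of R_Ring (NormedModule.AbelianGroup D V).
Proof.
apply (ModuleSpace.Mixin R_Ring (NormedModule.AbelianGroup D V)
  (fun r v => scal (real_scalar D r) v)).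
- intros r s v; rewrite scal_assoc; now rewrite <- real_scalar_mult.
- intros v; change (one : R_Ring) with 1; rewrite real_scalar_one; apply scal_one.
- intros r u v; apply (scal_distr_l (real_scalar D r) u v).
- intros r s v; change (plus r s) with (r + s); rewrite real_scalar_plus.
  apply (scal_distr_r (V := V)).
Defined.

Definition real_NormedModuleAux (V : NormedModule D) : NormedModuleAux R_AbsRing :=
  NormedModuleAux.Pack R_AbsRing V
    (NormedModuleAux.Class R_AbsRing V
      (ModuleSpace.Class R_Ring V _ (real_ModuleSpace_mixin V))
      (UniformSpace.class (NormedModule.UniformSpace D V))) V.

Definition real_NormedModule_mixin (V : NormedModule D) :
  NormedModule.mixin_of R_AbsRing (real_NormedModuleAux V).
Proof.
apply (NormedModule.Mixin R_AbsRing (real_NormedModuleAux V)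
  (fun v : V => norm v) (@norm_factor D V)).
- intros x y; apply (norm_triangle (V := V)).
- intros r x; change (abs r) with (Rabs r); rewrite <- (real_scalar_abs D).
  apply (norm_scal (V := V)).
- intros x y eps; apply (norm_compat1 (V := V)).
- intros x y eps; apply (norm_compat2 (V := V)).
- intros x; apply (norm_eq_zero (V := V)).
Defined.

Definition real_module (V : NormedModule D) : NormedModule R_AbsRing :=
  NormedModule.Pack R_AbsRing V
    (NormedModule.Class R_AbsRing V _ (real_NormedModule_mixin V)) V.

Lemma real_module_complete (V : NormedModule D) :
  filter_complete V -> filter_complete (real_module V).
Proof. exact (fun H => H). Qed.

Lemma complete_module_filter_complete (V : CompleteNormedModule D) :
  filter_complete V.
Proof.
intros F HF HC; exact (ex_intro _ (lim F) (complete_cauchy F HF HC)).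
Qed.

Lemma real_is_linear {U V : NormedModule D} (l : U -> V) :
  is_linear l -> @is_linear R_AbsRing (real_module U) (real_module V) l.
Proof.
intros [H1 H2 H3]; split; [exact H1 | | exact H3].
intros r x; exact (H2 (real_scalar D r) x).
Qed.

Lemma real_filterdiff {U V : NormedModule D} (f l : U -> V) (x : U) :
  filterdiff f (locally x) l ->
  @filterdiff R_AbsRing (real_module U) (real_module V) f (locally x) l.
Proof.
intros [H1 H2]; exact (conj (real_is_linear l H1) H2).
Qed.

(** The remainder estimate does not involve scalars, so linearity over [D] is all that has to be
    supplied. *)
Lemma filterdiff_of_real {U V : NormedModule D} (f l : U -> V) (x : U) :
  is_linear l ->
  @filterdiff R_AbsRing (real_module U) (real_module V) f (locally x) l ->
  filterdiff f (locally x) l.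
Proof.
intros H1 [_ H2]; exact (conj H1 H2).
Qed.

End RealModule.

(** Both estimates are taken at [x + s h] for a small real [s > 0]; they bound [s (l1 h - l2 h)] by
    [s * eps], and [s] cancels. *)
Lemma filterdiff_unicity {U V : NormedModule R_AbsRing} (f l1 l2 : U -> V) (x : U) :
  filterdiff f (locally x) l1 -> filterdiff f (locally x) l2 ->
  forall h, l1 h = l2 h.
Proof.
intros [L1 H1]%filterdiff_norm_iff [L2 H2]%filterdiff_norm_iff h.
assert (Hh := norm_ge_0 h).
assert (E : norm (minus (l1 h) (l2 h)) = 0).
{ apply Rle_antisym; [|apply norm_ge_0].
  apply le_epsilon; intros eps Heps; rewrite Rplus_0_l.
  assert (He : 0 < eps / 2 / (norm h + 1)) by (repeat apply Rdiv_lt_0_compat; lra).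
  destruct (proj1 (locally_norm_iff _ _) (H1 (mkposreal _ He))) as [d1 [Hd1 G1]].
  destruct (proj1 (locally_norm_iff _ _) (H2 (mkposreal _ He))) as [d2 [Hd2 G2]].
  simpl in G1, G2.
  assert (Hm := Rmin_glb_lt _ _ _ Hd1 Hd2).
  set (s := Rmin d1 d2 / (norm h + 1)).
  assert (Hs : 0 < s) by (apply Rdiv_lt_0_compat; lra).
  assert (Hsh : s * norm h < Rmin d1 d2).
  { apply Rlt_le_trans with (s * (norm h + 1)); [apply Rmult_lt_compat_l; lra|].
    right; unfold s; field; lra. }
  set (y := plus x (scal s h)).
  assert (Ey : minus y x = scal s h) by (unfold y; module_eq U).
  assert (Ny : norm (minus y x) = s * norm h)
    by (unfold y; norm_as (scal s h); rewrite norm_scal_real, Rabs_right; lra).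
  assert (Hy1 : norm (minus y x) < d1)
    by (rewrite Ny; apply Rlt_le_trans with (1 := Hsh), Rmin_l).
  assert (Hy2 : norm (minus y x) < d2)
    by (rewrite Ny; apply Rlt_le_trans with (1 := Hsh), Rmin_r).
  specialize (G1 y Hy1); specialize (G2 y Hy2).
  rewrite Ny, Ey in G1, G2.
  rewrite (linear_scal _ L1) in G1; rewrite (linear_scal _ L2) in G2.
  assert (G : norm (scal s (minus (l1 h) (l2 h))) <= s * eps).
  { apply Rle_trans with (eps / 2 / (norm h + 1) * (s * norm h)
                          + eps / 2 / (norm h + 1) * (s * norm h)).
    - norm_as (minus (minus (minus (f y) (f x)) (scal s (l2 h)))
                     (minus (minus (f y) (f x)) (scal s (l1 h)))).
      eapply Rle_trans; [apply (norm_triangle (V := V))|].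
      rewrite norm_opp; apply Rplus_le_compat; assumption.
    - apply Rle_trans with (s * (eps * (norm h / (norm h + 1)))).
      + right; field; lra.
      + apply Rmult_le_compat_l; [lra|].
        rewrite <- (Rmult_1_r eps) at 2; apply Rmult_le_compat_l; [lra|].
        apply Rmult_le_reg_r with (norm h + 1); [lra|].
        unfold Rdiv; rewrite Rmult_assoc, Rinv_l; lra. }
  rewrite norm_scal_real, Rabs_right in G by lra.
  now apply Rmult_le_reg_l in G. }
apply norm_eq_zero in E.
replace (l1 h) with (plus (minus (l1 h) (l2 h)) (l2 h)) by module_eq V.
rewrite E; apply plus_zero_l.
Qed.

Lemma geometric_nonpos (x C : R) : (forall k, x <= C * (1 / 2) ^ k) -> x <= 0.
Proof.
intros H; apply le_epsilon; intros eps Heps; rewrite Rplus_0_l.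
assert (Hlt : Rabs (1 / 2) < 1) by (rewrite Rabs_right; lra).
assert (HC := Rabs_pos C).
assert (He : 0 < eps / (Rabs C + 1)) by (apply Rdiv_lt_0_compat; lra).
destruct (pow_lt_1_zero (1 / 2) Hlt _ He) as [k Hk].
specialize (Hk k (le_n k)); rewrite Rabs_right in Hk by (apply Rle_ge, pow_le; lra).
assert (Hq : 0 < (1 / 2) ^ k) by (apply pow_lt; lra).
eapply Rle_trans; [apply (H k)|].
apply Rle_trans with ((Rabs C + 1) * (1 / 2) ^ k).
- apply Rmult_le_compat_r; [lra | generalize (Rle_abs C); lra].
- apply Rmult_lt_compat_l with (r := Rabs C + 1) in Hk; [|lra].
  replace ((Rabs C + 1) * (eps / (Rabs C + 1))) with eps in Hk by (field; lra); lra.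
Qed.

Lemma sum_n_m_term_le (a : nat -> R) (n i : nat) :
  (forall k, 0 <= a k) -> (1 <= i <= n)%nat -> a i <= sum_n_m a 1 n.
Proof.
intros Ha; induction n as [|n IH]; intros Hi; [lia|].
rewrite sum_n_Sm by lia; change plus with Rplus.
destruct (Nat.eq_dec i (S n)) as [->|Hne].
- assert (0 <= sum_n_m a 1 n); [|lra].
  apply Rle_trans with (sum_n_m (fun _ => 0) 1 n).
  + right; symmetry; apply (sum_n_m_const_zero (G := R_AbelianMonoid)).
  + now apply sum_n_m_le.
- specialize (IH ltac:(lia)); specialize (Ha (S n)); lra.
Qed.

Lemma sum_n_m_Rmult (r : R) (a : nat -> R) (n m : nat) :
  sum_n_m (fun i => r * a i) n m = r * sum_n_m a n m.
Proof. exact (sum_n_m_mult_l (K := R_Ring) r a n m). Qed.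

Lemma sum_n_m_Rplus (a b : nat -> R) (n m : nat) :
  sum_n_m (fun i => a i + b i) n m = sum_n_m a n m + sum_n_m b n m.
Proof. exact (sum_n_m_plus (G := R_AbelianMonoid) a b n m). Qed.

Lemma sum_n_m_le_range (a b : nat -> R) (n : nat) :
  (forall i, (1 <= i <= n)%nat -> a i <= b i) -> sum_n_m a 1 n <= sum_n_m b 1 n.
Proof.
induction n as [|n IH]; intros H.
- rewrite !sum_n_m_zero by lia; apply Rle_refl.
- rewrite !sum_n_Sm by lia; apply Rplus_le_compat; [apply IH; intros; apply H; lia|].
  apply H; lia.
Qed.

Lemma linear_sum {K : AbsRing} {U V : NormedModule K} (l : U -> V) (a : nat -> U) (n m : nat) :
  is_linear l -> l (sum_n_m a n m) = sum_n_m (fun i => l (a i)) n m.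
Proof.
intros Hl; induction m as [|m IH].
- destruct (Nat.eq_dec n 0) as [->|Hn].
  + now rewrite !sum_n_n.
  + rewrite !sum_n_m_zero by lia; apply (linear_zero l Hl).
- destruct (le_dec n (S m)) as [Hle|Hgt].
  + rewrite !sum_n_Sm by lia; now rewrite (linear_plus l Hl), IH.
  + rewrite !sum_n_m_zero by lia; apply (linear_zero l Hl).
Qed.

(** * Boundedness of the coordinate functionals of a basis *)

Section Coordinates.

Context {D : RealBanachRing}.

Definition combination {V : NormedModule D} (n : nat) (e : nat -> V) (c : nat -> D) : V :=
  sum_n_m (fun i => scal (c i) (e i)) 1 n.

Lemma combination_plus {V : NormedModule D} (n : nat) (e : nat -> V) (c d : nat -> D) :
  combination n e (fun i => plus (c i) (d i)) = plus (combination n e c) (combination n e d).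
Proof.
unfold combination; rewrite <- sum_n_m_plus; apply sum_n_m_ext; intros i.
apply (scal_distr_r (V := V)).
Qed.

Lemma combination_scal {V : NormedModule D} (n : nat) (e : nat -> V) (d : D) (c : nat -> D) :
  combination n e (fun i => mult d (c i)) = scal d (combination n e c).
Proof.
unfold combination; rewrite <- sum_n_m_scal_l; apply sum_n_m_ext; intros i.
symmetry; apply (scal_assoc (V := V)).
Qed.

Lemma combination_minus {V : NormedModule D} (n : nat) (e : nat -> V) (c d : nat -> D) :
  combination n e (fun i => minus (c i) (d i)) = minus (combination n e c) (combination n e d).
Proof.
assert (H : combination n e c =
  plus (combination n e (fun i => minus (c i) (d i))) (combination n e d)).
{ rewrite <- combination_plus; apply sum_n_m_ext; intros k.
  f_equal; symmetry; exact (minus_plus_cancel (G := D) (c k) (d k)). }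
apply (plus_reg_r (combination n e d)).
exact (eq_trans (eq_sym H) (eq_sym (minus_plus_cancel _ _))).
Qed.

Lemma basis_unicity {V : NormedModule D} (n : nat) (e : nat -> V) (c d : nat -> D) :
  is_basis n e -> combination n e c = combination n e d ->
  forall i, (1 <= i <= n)%nat -> c i = d i.
Proof.
intros [_ Hf] H i Hi.
assert (E : minus (c i) (d i) = zero).
{ refine (Hf (fun i => minus (c i) (d i)) _ i Hi).
  change (combination n e (fun i => minus (c i) (d i)) = zero).
  rewrite combination_minus, H; apply (minus_eq_zero (G := V)). }
exact (minus_zero_eq (G := D) _ _ E).
Qed.

Lemma linear_ext_basis {V W : NormedModule D} (n : nat) (e : nat -> V) (l1 l2 : V -> W) :
  is_basis n e -> is_linear l1 -> is_linear l2 ->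
  (forall i, (1 <= i <= n)%nat -> l1 (e i) = l2 (e i)) -> forall v, l1 v = l2 v.
Proof.
intros [Hg _] H1 H2 H v; destruct (Hg v) as [c ->].
rewrite (linear_sum l1), (linear_sum l2) by assumption.
apply sum_n_m_ext_loc; intros i Hi.
now rewrite (linear_scal _ H1), (linear_scal _ H2), H.
Qed.

Lemma combination_close {V : NormedModule D} (n : nat) (e : nat -> V) (c d : nat -> D) (r : R) :
  (forall i, (1 <= i <= n)%nat -> abs (minus (c i) (d i)) <= r) ->
  norm (minus (combination n e c) (combination n e d))
    <= r * sum_n_m (fun i => norm (e i)) 1 n.
Proof.
intros H.
replace (minus (combination n e c) (combination n e d))
  with (combination n e (fun i => minus (c i) (d i))).
- eapply Rle_trans; [apply norm_sum_n_m|].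
  rewrite <- sum_n_m_Rmult; apply sum_n_m_le_range; intros i Hi.
  eapply Rle_trans; [apply norm_scal|].
  apply Rmult_le_compat_r; [apply norm_ge_0 | apply H, Hi].
- apply combination_minus.
Qed.

Section BasisCoordinates.

Context {V : NormedModule D}.
Hypothesis V_complete : filter_complete V.
Variable n : nat.
Variable e : nat -> V.
Hypothesis e_basis : is_basis n e.
(** A chosen coordinate family for each vector; its values outside 1, ..., [n] are arbitrary, hence
    the range conditions on indices. *)
Variable x : V -> nat -> D.
Hypothesis x_spec : forall v : V, v = combination n e (x v).

Lemma coord_combination (c : nat -> D) (i : nat) :
  (1 <= i <= n)%nat -> x (combination n e c) i = c i.
Proof. intros Hi; apply (basis_unicity n e); auto. Qed.

Lemma coord_plus (u v : V) (i : nat) :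
  (1 <= i <= n)%nat -> x (plus u v) i = plus (x u i) (x v i).
Proof.
intros Hi; rewrite (x_spec u), (x_spec v) at 1.
rewrite <- combination_plus; now apply coord_combination.
Qed.

Lemma coord_scal (d : D) (v : V) (i : nat) :
  (1 <= i <= n)%nat -> x (scal d v) i = mult d (x v i).
Proof.
intros Hi; rewrite (x_spec v) at 1.
rewrite <- combination_scal; now apply coord_combination.
Qed.

Lemma coord_zero (i : nat) : (1 <= i <= n)%nat -> x zero i = zero.
Proof.
intros Hi; apply (plus_reg_r (x zero i)).
rewrite <- coord_plus, plus_zero_l, plus_zero_l by exact Hi; reflexivity.
Qed.

Lemma coord_minus (u v : V) (i : nat) :
  (1 <= i <= n)%nat -> x (minus u v) i = minus (x u i) (x v i).
Proof.
intros Hi; apply (plus_reg_r (x v i)); rewrite <- coord_plus by exact Hi.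
exact (eq_trans (f_equal (fun w => x w i) (minus_plus_cancel u v))
  (eq_sym (minus_plus_cancel (G := D) _ _))).
Qed.

Definition coord_norm (v : V) : R := sum_n_m (fun i => abs (x v i)) 1 n.

(** Each coordinate of the partial sums converges in [D], by completeness, at a geometric rate. The
    limits are the coordinates of [v], because combinations depend continuously on their
    coefficients. *)
Lemma coord_norm_series (s : nat -> V) (v : V) (C C' : R) :
  s O = zero ->
  (forall k, coord_norm (minus (s (S k)) (s k)) <= C * (1 / 2) ^ k) ->
  (forall k, norm (minus v (s k)) <= C' * (1 / 2) ^ k) ->
  coord_norm v <= INR (S n - 1) * 2 * C.
Proof.
intros H0 Hp Hn.
assert (Hlim : forall i, exists l : D, (1 <= i <= n)%nat ->
  forall k, abs (minus l (x (s k) i)) <= 2 * (C * (1 / 2) ^ k)).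
{ intros i; destruct (classic (1 <= i <= n)%nat) as [Hi|Hi];
    [|exists zero; tauto].
  destruct (nested_limit (V := real_module (AbsRing_NormedModule D))
    (real_module_complete _ (rbr_complete D))
    (fun k => x (s k) i) (fun k => C * (1 / 2) ^ k)) as [l Hl].
  - intros k; eapply Rle_trans; [|apply (Hp k)].
    eapply Rle_trans; [|apply (sum_n_m_term_le
      (fun i => abs (x (minus (s (S k)) (s k)) i)) n i)].
    + rewrite coord_minus by exact Hi; apply Rle_refl.
    + intros j; apply abs_ge_0.
    + exact Hi.
  - intros k; simpl; lra.
  - exists l; intros _; exact Hl. }
destruct (choice _ Hlim) as [c Hc].
assert (E : v = combination n e c).
{ set (Se := sum_n_m (fun i => norm (e i)) 1 n).
  assert (Hz : norm (minus v (combination n e c)) <= 0).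
  (* [C'] accounts for the distance from [v] to [s k], and [2 * C * Se] for the one from [s k] to
     the combination of the limits. *)
  { apply (geometric_nonpos _ (C' + 2 * C * Se)); intros k.
    replace (minus v (combination n e c)) with
      (plus (minus v (s k)) (minus (s k) (combination n e c)))
      by (symmetry; apply minus_trans).
    eapply Rle_trans; [apply norm_triangle|].
    rewrite Rmult_plus_distr_r; apply Rplus_le_compat; [apply Hn|].
    rewrite (x_spec (s k)).
    eapply Rle_trans; [apply (combination_close n e _ _ (2 * (C * (1 / 2) ^ k)))|].
    - intros i Hi; rewrite <- abs_opp, opp_minus; now apply Hc.
    - fold Se; right; ring. }
  assert (E : minus v (combination n e c) = zero)
    by (apply norm_eq_zero, Rle_antisym; [exact Hz | apply norm_ge_0]).
  exact (minus_zero_eq _ _ E). }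
unfold coord_norm.
apply Rle_trans with (sum_n_m (fun _ => 2 * C) 1 n).
- apply sum_n_m_le_range; intros i Hi.
  rewrite E, coord_combination by exact Hi.
  (* Since the sequence starts at zero, the estimate at index 0 bounds the coordinate itself by
     [2 * C]. *)
  specialize (Hc i Hi O); rewrite H0, coord_zero in Hc by exact Hi.
  rewrite pow_O, Rmult_1_r in Hc.
  eapply Rle_trans; [|exact Hc].
  right; apply f_equal; symmetry; exact (minus_zero_r (G := D) (c i)).
- rewrite sum_n_m_const; right; ring.
Qed.

(** [coord_norm] is a countably subadditive seminorm on the underlying real space, so Zabreiko's
    lemma bounds it by the norm. *)
Lemma coord_bounded : exists M, 0 < M /\ forall v i, (1 <= i <= n)%nat ->
  abs (x v i) <= M * norm v.
Proof.
destruct (countably_subadditive_bounded (V := real_module V)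
  (real_module_complete V V_complete) coord_norm) with (K := INR (S n - 1) * 2) as [M [HM H]].
- intros u v; unfold coord_norm.
  rewrite <- sum_n_m_Rplus.
  apply sum_n_m_le_range; intros i Hi.
  apply Rle_trans with (abs (plus (x u i) (x v i))); [|apply abs_triangle].
  right; exact (f_equal abs (coord_plus u v i Hi)).
- intros r u; unfold coord_norm.
  rewrite <- sum_n_m_Rmult.
  apply sum_n_m_le_range; intros i Hi.
  rewrite <- (real_scalar_abs D r).
  apply Rle_trans with (abs (mult (real_scalar D r) (x u i))); [|apply abs_mult].
  right; exact (f_equal abs (coord_scal (real_scalar D r) u i Hi)).
- exact coord_norm_series.
- exists M; split; [exact HM|]; intros v i Hi.
  eapply Rle_trans; [|apply (H v)].
  apply (sum_n_m_term_le (fun i => abs (x v i)) n i); [intros j; apply abs_ge_0 | exact Hi].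
Qed.

Lemma coord_linear (i : nat) : (1 <= i <= n)%nat ->
  @is_linear D V (AbsRing_NormedModule D) (fun v => x v i).
Proof.
intros Hi; split.
- intros u v; now apply coord_plus.
- intros d v; now apply coord_scal.
- destruct coord_bounded as [M [HM H]]; exists M; split; [exact HM|].
  intros v; now apply H.
Qed.

End BasisCoordinates.

End Coordinates.

(** * Integrability over D *)

Section Derivative.

Context {D : RealBanachRing} {A B : NormedModule D}.
Hypothesis A_complete : filter_complete A.
Hypothesis B_complete : filter_complete B.
Variable g : A -> LinMap D A B.
Variable dg : A -> A -> LinMap D A B.
Hypothesis dg_spec : forall x, filterdiff g (locally x) (dg x).

Lemma lin_eval_linear (h : A) : is_linear (fun l : LinMap D A B => l h).
Proof.
split; [reflexivity | reflexivity |].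
exists (norm h + 1); split; [generalize (norm_ge_0 h); lra|].
intros l; change (norm l) with (lin_norm l).
assert (H := lin_norm_bound l h); assert (H' := lin_norm_ge_0 l); lra.
Qed.

(** Reduction to real scalars: since [g x] is already linear over [D], it is a derivative over [D]
    exactly when it is one over the reals. *)
Lemma integrable_iff_second_derivative_symmetric :
  integrable g <-> forall x h k, dg x h k = dg x k h.
Proof.
assert (HL := fun x => proj1 (dg_spec x)).
assert (E : integrable g <-> exists f : A -> B, forall x : A,
  @filterdiff R_AbsRing (real_module A) (real_module B) f (locally x) (g x)).
{ split; intros [f Hf]; exists f; intros x.
  - apply real_filterdiff, Hf.
  - apply filterdiff_of_real; [apply lin_is_linear | apply Hf]. }
rewrite E; clear E.
apply (integrable_iff_symmetric (A := real_module A) (B := real_module B)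
  (real_module_complete A A_complete) (real_module_complete B B_complete)
  (fun x => g x) (fun x h => dg x h)).
- intros x; apply real_is_linear, lin_is_linear.
- intros x k; apply (real_is_linear (fun h => dg x h k)).
  exact (is_linear_comp (dg x) (fun l : LinMap D A B => l k) (HL x) (lin_eval_linear k)).
- intros x h; apply real_is_linear, lin_is_linear.
- intros x; destruct (linear_norm _ (HL x)) as [M [HM H]]; exists M; split; [exact HM|].
  intros h k; eapply Rle_trans; [apply (lin_norm_bound (dg x h) k)|].
  apply Rmult_le_compat_r; [apply norm_ge_0 | apply H].
- intros x eps Heps.
  destruct (proj1 (filterdiff_norm_iff _ _ _) (dg_spec x)) as [_ H].
  destruct (proj1 (locally_norm_iff (V := real_module A) _ _) (H (mkposreal eps Heps)))
    as [d [Hd Hg]].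
  exists d; split; [exact Hd|]; intros y Hy h.
  eapply Rle_trans;
    [apply (lin_norm_bound (minus (minus (g y) (g x)) (dg x (minus y x))) h)|].
  apply Rmult_le_compat_r; [apply norm_ge_0 | exact (Hg y Hy)].
Qed.

(** By bilinearity, the two arguments are reduced to basis vectors one after the other. *)
Lemma second_derivative_symmetric_basis (m : nat) (e : nat -> A) (x : A) :
  is_basis m e ->
  (forall j k, (1 <= j <= m)%nat -> (1 <= k <= m)%nat -> dg x (e k) (e j) = dg x (e j) (e k)) ->
  forall h k, dg x h k = dg x k h.
Proof.
intros He H h k.
assert (HL : forall k, is_linear (fun h => dg x h k)).
{ intros l; exact (is_linear_comp (dg x) (fun u : LinMap D A B => u l)
    (proj1 (dg_spec x)) (lin_eval_linear l)). }
apply (linear_ext_basis m e (dg x h) (fun k => dg x k h) He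
  (lin_is_linear _) (HL h)); intros j Hj.
apply (linear_ext_basis m e (fun h => dg x h (e j)) (dg x (e j)) He
  (HL (e j)) (lin_is_linear _)); intros i Hi.
now apply H.
Qed.

Lemma partial_unicity (u : A -> D) (e x : A) (v : D)
    (l : LinMap D A (AbsRing_NormedModule D)) :
  filterdiff u (locally x) l -> is_partial u e x v -> v = l e.
Proof.
intros Hl [l' [Hl' <-]].
exact (filterdiff_unicity (U := real_module A)
  (V := real_module (AbsRing_NormedModule D)) u l' l x
  (real_filterdiff _ _ _ Hl') (real_filterdiff _ _ _ Hl) e).
Qed.

(** Evaluation at [eA j] and the coordinate functionals are bounded and linear, so by the chain rule
    the partial derivative of [gc i j] along [eA k] is the [i]-th coordinate of
    [dg x (eA k) (eA j)]. Compatibility is thus symmetry on basis vectors, read coordinate by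
    coordinate. *)
Lemma completely_integrable_iff_symmetric (m n : nat) (eA : nat -> A) (eB : nat -> B)
    (gc : nat -> nat -> A -> D) :
  is_basis m eA -> is_basis n eB ->
  (forall x j, (1 <= j <= m)%nat ->
     g x (eA j) = sum_n_m (fun i => scal (gc i j x) (eB i)) 1 n) ->
  (completely_integrable m n eA gc <-> forall x h k, dg x h k = dg x k h).
Proof.
intros HA HB Hgc.
destruct (choice _ (proj1 HB)) as [c Hc].
assert (Hl := coord_linear B_complete n eB HB c Hc).
assert (Hd : forall i j, (1 <= i <= n)%nat -> (1 <= j <= m)%nat -> forall x,
  exists l : LinMap D A (AbsRing_NormedModule D),
    filterdiff (gc i j) (locally x) l /\ forall h, l h = c (dg x h (eA j)) i).
{ intros i j Hi Hj x.
  assert (H : filterdiff (fun y => c (g y (eA j)) i : AbsRing_NormedModule D)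
                (locally x) (fun h => c (dg x h (eA j)) i)).
  { apply (filterdiff_comp' (fun y => g y (eA j)) (fun v => c v i) x
      (fun h => dg x h (eA j)) (fun v => c v i)).
    - apply (filterdiff_comp' g (fun l : LinMap D A B => l (eA j)) x
        (dg x) (fun l : LinMap D A B => l (eA j))).
      + apply dg_spec.
      + apply filterdiff_linear, lin_eval_linear.
    - apply filterdiff_linear, Hl, Hi. }
  exists (Build_LinMap _ _ _ _ (proj1 H)); split; [|reflexivity].
  apply filterdiff_ext with (2 := H); intros y.
  rewrite (Hgc y j Hj); apply (coord_combination n eB HB c Hc (fun i => gc i j y) i Hi). }
split.
- intros H x; apply (second_derivative_symmetric_basis m eA x HA); intros j k Hj Hk.
  rewrite (Hc (dg x (eA k) (eA j))), (Hc (dg x (eA j) (eA k))).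
  apply sum_n_m_ext_loc; intros i Hi; f_equal.
  destruct (H i j k Hi Hj Hk x) as [v [H1 H2]].
  destruct (Hd i j Hi Hj x) as [l1 [D1 L1]]; destruct (Hd i k Hi Hk x) as [l2 [D2 L2]].
  rewrite <- L1, <- L2.
  (* The common value [v] of the two partial derivatives is identified, on each side, with the one
     computed by the chain rule. *)
  rewrite <- (partial_unicity _ _ _ _ _ D1 H1); exact (partial_unicity _ _ _ _ _ D2 H2).
- intros H i j k Hi Hj Hk x; exists (c (dg x (eA k) (eA j)) i).
  destruct (Hd i j Hi Hj x) as [l1 [D1 L1]]; destruct (Hd i k Hi Hk x) as [l2 [D2 L2]].
  split; [exists l1 | exists l2]; split; auto.
  rewrite L2, H; reflexivity.
Qed.

End Derivative.

Theorem theorem6p5p5 :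
  forall (D : RealBanachRing) (A : CompleteNormedModule D) (B : BanachAlgebra D)
    (m n : nat) (eA : nat -> A) (eB : nat -> B)
    (g : A -> LinMap D A B) (gc : nat -> nat -> A -> D),
    is_basis m eA ->
    is_basis n eB ->
    differentiable g ->
    (forall (x : A) (j : nat), (1 <= j <= m)%nat ->
       g x (eA j) = sum_n_m (fun i => scal (gc i j x) (eB i)) 1 n) ->
    (integrable g <-> completely_integrable m n eA gc).
Proof.
intros D A B m n eA eB g gc HA HB Hg Hgc.
destruct (choice _ Hg) as [dg Hdg].
assert (CA := complete_module_filter_complete A).
assert (CB := complete_module_filter_complete B).
rewrite (completely_integrable_iff_symmetric CB g dg Hdg m n eA eB gc HA HB Hgc).
exact (integrable_iff_second_derivative_symmetric CA CB g dg Hdg).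
Qed.
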